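(* Let $G$ be a finitely generated sofic group and let $X$ be an algebraic variety over an algebraically closed field. Let $M\subset G$ be finite and let $S$ be the set of morphisms of algebraic varieties $X^M\to X$. Suppose that $s,t\in S^G$ have uniformly bounded singularity and that $\sigma_s\circ\sigma_t=\mathrm{Id}_{X^G}$. Then $\sigma_t\circ\sigma_s=\mathrm{Id}_{X^G}$.
   Context: Sofic group (standard notion): $G$ is sofic if for every finite $K\subset G$ and every $\varepsilon>0$ there exist $n\ge 1$ and a map $\varphi\colon G\to \mathrm{Sym}(n)$ with $d_H(\varphi(gh),\varphi(g)\varphi(h))\le\varepsilon$ for all $g,h\in K$ and $d_H(\varphi(g),\varphi(h))\ge 1-\varepsilon$ for all distinct $g,h\in K$, where $d_H$ is the normalized Hamming distance. An algebraic variety is a reduced separated scheme of finite type over an algebraically closed field, and it is identified with its set of closed points. $X^M$ is the fibered product over the base field of copies of $X$ indexed by $M$ (its closed points are the maps $M\to X$); $X^G$ is the set of maps $G\to X$ (with $X$ identified with its closed points). The group $G$ acts on $X^G$ by $(gx)(h)=x(g^{-1}h)$. For $s\in S^G$ (a map $G\to S$), $\sigma_s\colon X^G\to X^G$ is defined by $\sigma_s(x)(g)=s(g)\big((g^{-1}x)|_M\big)$ for $x\in X^G$, $g\in G$. A configuration $s\in S^G$ has uniformly bounded singularity if for every finite $E\subset G$ with $1_G\in E=E^{-1}$ there is a finite $F\subset G$ containing $E$ such that the restriction $s|_{FE\setminus F}$ is constant. *)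

(* Defs.v *)
(* Varieties over an algebraically closed field k are identified with their
   sets of closed points: a variety is the topological space of its closed
   points (Zariski topology) together with its sheaf of regular k-valued
   functions (Serre's definition).  This is the usual dictionary for reduced
   schemes of finite type over k; k-morphisms become the continuous maps that
   pull regular functions back to regular functions. *)
From HB Require Import structures.
From mathcomp Require Import all_boot all_order all_algebra all_fingroup.
From mathcomp Require Import finmap.
From mathcomp Require Import boolp classical_sets functions reals topology.

Set Implicit Arguments.
Unset Strict Implicit.
Unset Printing Implicit Defensive.

Import Order.TTheory GRing.Theory Num.Theory.
Local Open Scope classical_set_scope.
Local Open Scope ring_scope.

(* A space with functions.  [regular U] is meaningful for open U only.  A
   section over U is represented by a total function of which only the values
   on U matter: [regular_glue] contains both this and the sheaf axiom. *)
Record funSpace (k : fieldType) := FunSpace {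
  space :> topologicalType;
  regular : set space -> (space -> k) -> Prop;
  regular_sub : forall (U V : set space) f,
    open V -> V `<=` U -> regular U f -> regular V f;
  regular_glue : forall (U : set space) f,
    (forall x, U x -> exists V g,
       [/\ open V, V x, V `<=` U, regular V g & forall y, V y -> f y = g y]) ->
    regular U f;
  regular_cst : forall (U : set space) c, open U -> regular U (fun=> c);
  regularD : forall (U : set space) f g, open U ->
    regular U f -> regular U g -> regular U (fun x => f x + g x);
  regularM : forall (U : set space) f g, open U ->
    regular U f -> regular U g -> regular U (fun x => f x * g x);
  regular_open : forall (U : set space) f, open U ->
    regular U f -> open (U `&` [set x | f x != 0]);
  regularV : forall (U : set space) f, open U ->
    regular U f -> regular (U `&` [set x | f x != 0]) (fun x => (f x)^-1)
}.

Definition is_morphism (k : fieldType) (X Y : funSpace k) (h : X -> Y) : Prop :=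
  continuous h /\
  forall (U : set Y) f, open U -> regular U f -> regular (h @^-1` U) (f \o h).

Record var_morphism (k : fieldType) (X Y : funSpace k) := VarMorphism {
  mor_fun :> X -> Y;
  mor_morphism : is_morphism mor_fun
}.

Definition isomorphic (k : fieldType) (X Y : funSpace k) : Prop :=
  exists (f : var_morphism X Y) (g : var_morphism Y X), cancel f g /\ cancel g f.

(* The coarsest structure of space with functions on T for which, for every
   (U, f) in B, the set U is open and f is regular on U.  Affine spaces,
   subspaces and products are instances; [gen_spaceP] is their common
   universal property. *)
Definition gen_carrier (k : fieldType) (T : choiceType)
  (B : set T -> (T -> k) -> Prop) : Type := T.

Section GeneratedSpace.
Variables (k : fieldType) (T : choiceType) (B : set T -> (T -> k) -> Prop).

Inductive gen_section : set T -> (T -> k) -> Prop :=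
| gen_section_gen U f of B U f : gen_section U f
| gen_section_cst c : gen_section setT (fun=> c)
| gen_sectionD U V f g of gen_section U f & gen_section V g :
    gen_section (U `&` V) (fun x => f x + g x)
| gen_sectionM U V f g of gen_section U f & gen_section V g :
    gen_section (U `&` V) (fun x => f x * g x).

Definition gen_open (W : set T) : Prop :=
  forall x, W x -> exists U f, [/\ gen_section U f, U x, f x != 0 &
    forall y, U y -> f y != 0 -> W y].

Definition gen_regular (W : set T) (h : T -> k) : Prop :=
  forall x, W x -> exists U V f g,
    [/\ gen_section U f, gen_section V g, U x /\ V x, g x != 0 &
        forall y, U y -> V y -> g y != 0 -> W y /\ h y = f y / g y].

HB.instance Definition _ := Choice.on (gen_carrier B).

Let gen_openT : gen_open setT.
Proof.
move=> x _; exists setT, (fun=> 1); split=> //; last exact: oner_neq0.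
exact: gen_section_cst.
Qed.

Let gen_openI : setI_closed gen_open.
Proof.
move=> A A' oA oA' x [Ax A'x].
have [U [f [sf Ux fx UA]]] := oA _ Ax; have [V [g [sg Vx gx VA]]] := oA' _ A'x.
exists (U `&` V), (fun x => f x * g x); split=> //.
- exact: gen_sectionM.
- by rewrite mulf_neq0.
- by move=> y [Uy Vy]; rewrite mulf_eq0 negb_or => /andP[fy gy]; split; auto.
Qed.

Let gen_open_bigU (I : Type) (f : I -> set T) :
  (forall i, gen_open (f i)) -> gen_open (\bigcup_i f i).
Proof.
move=> of_ x [i _ fx]; have [U [g [sg Ux gx UA]]] := of_ i _ fx.
by exists U, g; split=> // y Uy gy; exists i => //; exact: UA.
Qed.

HB.instance Definition _ := isOpenTopological.Build (gen_carrier B)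
  gen_openT gen_openI gen_open_bigU.

Lemma gen_openE (W : set (gen_carrier B)) : open W <-> gen_open W.
Proof.
split=> [|oW]; rewrite openE.
  move=> oW x /oW [A [oA Ax AW]]; have [U [f [sf Ux fx UA]]] := oA _ Ax.
  by exists U, f; split=> // y Uy fy; exact/AW/UA.
by move=> x Wx; exists W; split.
Qed.

Let gen_regular_open W h : gen_regular W h -> gen_open W.
Proof.
move=> rh x /rh [U [V [f [g [sf sg [Ux Vx] gx UVW]]]]].
exists (U `&` V), (fun x => (0 * f x + 1) * g x); split=> //.
- have := gen_sectionM (gen_sectionD (gen_sectionM (gen_section_cst 0) sf)
    (gen_section_cst 1)) sg.
  by rewrite setTI setIT.
- by rewrite mul0r add0r mul1r.
- by move=> y [Uy Vy]; rewrite mul0r add0r mul1r => /(UVW _ Uy Vy)[].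
Qed.

Let gen_regular_sub (U V : set (gen_carrier B)) f :
  open V -> V `<=` U -> gen_regular U f -> gen_regular V f.
Proof.
move=> /gen_openE oV VU rf x Vx.
have [D [u [su Dx ux DV]]] := oV _ Vx.
have [W [W' [p [q [sp sq [Wx W'x] qx WU]]]]] := rf _ (VU _ Vx).
exists (W `&` D), (W' `&` D), (fun x => p x * u x), (fun x => q x * u x).
split=> //; [exact: gen_sectionM|exact: gen_sectionM|by rewrite mulf_neq0|].
move=> y [Wy Dy] [W'y _]; rewrite mulf_eq0 negb_or => /andP[qy uy].
split; first exact: DV.
by have [_ ->] := WU _ Wy W'y qy; rewrite -mulf_div divff// mulr1.
Qed.

Let gen_regular_glue (U : set (gen_carrier B)) f :
  (forall x, U x -> exists V g, [/\ open V, V x, V `<=` U,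
     gen_regular V g & forall y, V y -> f y = g y]) -> gen_regular U f.
Proof.
move=> loc x /loc [V [g [_ Vx VU rg fg]]].
have [W [W' [p [q [sp sq Wx qx WV]]]]] := rg _ Vx.
exists W, W', p, q; split=> // y Wy W'y qy; have [Vy gy] := WV _ Wy W'y qy.
by split; [exact: VU|rewrite fg].
Qed.

Let gen_regular_cst (U : set (gen_carrier B)) c : open U -> gen_regular U (fun=> c).
Proof.
move=> /gen_openE oU x Ux; have [D [u [su Dx ux DU]]] := oU _ Ux.
exists (setT `&` D), D, (fun x => c * u x), u; split=> //.
  by apply: gen_sectionM => //; exact: gen_section_cst.
by move=> y [_ Dy] _ uy; split; [exact: DU|rewrite mulfK].
Qed.

Let gen_regularD (U : set (gen_carrier B)) f g : open U ->
  gen_regular U f -> gen_regular U g -> gen_regular U (fun x => f x + g x).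
Proof.
move=> _ rf rg x Ux.
have [A [A' [p [q [sp sq [Ax A'x] qx AU]]]]] := rf _ Ux.
have [C [C' [r [s [sr ss [Cx C'x] sx CU]]]]] := rg _ Ux.
exists ((A `&` C') `&` (C `&` A')), (A' `&` C'),
  (fun x => p x * s x + r x * q x), (fun x => q x * s x).
split=> //; first by apply: gen_sectionD; exact: gen_sectionM.
- exact: gen_sectionM.
- by rewrite mulf_neq0.
move=> y [[Ay C'y] [Cy A'y]] _; rewrite mulf_eq0 negb_or => /andP[qy sy].
have [Uy ->] := AU _ Ay A'y qy; have [_ ->] := CU _ Cy C'y sy.
by rewrite addf_div.
Qed.

Let gen_regularM (U : set (gen_carrier B)) f g : open U ->
  gen_regular U f -> gen_regular U g -> gen_regular U (fun x => f x * g x).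
Proof.
move=> _ rf rg x Ux.
have [A [A' [p [q [sp sq [Ax A'x] qx AU]]]]] := rf _ Ux.
have [C [C' [r [s [sr ss [Cx C'x] sx CU]]]]] := rg _ Ux.
exists (A `&` C), (A' `&` C'), (fun x => p x * r x), (fun x => q x * s x).
split=> //; [exact: gen_sectionM|exact: gen_sectionM|by rewrite mulf_neq0|].
move=> y [Ay Cy] [A'y C'y]; rewrite mulf_eq0 negb_or => /andP[qy sy].
have [Uy ->] := AU _ Ay A'y qy; have [_ ->] := CU _ Cy C'y sy.
by rewrite mulf_div.
Qed.

Let gen_regularV (U : set (gen_carrier B)) f : open U ->
  gen_regular U f -> gen_regular (U `&` [set x | f x != 0]) (fun x => (f x)^-1).
Proof.
move=> _ rf x [Ux /= fx].
have [A [A' [p [q [sp sq [Ax A'x] qx AU]]]]] := rf _ Ux.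
exists (A' `&` A'), (A `&` A'), (fun x => q x * q x), (fun x => p x * q x).
split=> //; [exact: gen_sectionM|exact: gen_sectionM| |].
  rewrite mulf_neq0//; apply: contra_neq fx => px.
  by have [_ ->] := AU _ Ax A'x qx; rewrite px mul0r.
move=> y [A'y _] [Ay _]; rewrite mulf_eq0 negb_or => /andP[py qy].
have [Uy ->] := AU _ Ay A'y qy; split.
  by split=> //=; rewrite mulf_neq0// invr_eq0.
by rewrite -mulf_div divff// mulr1 invf_div.
Qed.

Let gen_regular_open' (U : set (gen_carrier B)) f : open U ->
  gen_regular U f -> open (U `&` [set x | f x != 0]).
Proof.
by move=> oU rf; apply/gen_openE/gen_regular_open/(gen_regularV oU rf).
Qed.

Definition gen_space : funSpace k :=
  @FunSpace k (gen_carrier B) gen_regular gen_regular_sub gen_regular_glue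
    gen_regular_cst gen_regularD gen_regularM gen_regular_open' gen_regularV.

Lemma gen_space_section U f : gen_section U f ->
  open (U : set gen_space) /\ regular (U : set gen_space) f.
Proof.
move=> sf; have rf : gen_regular U f.
  move=> x Ux; exists U, setT, f, (fun=> 1); split=> //.
  - exact: gen_section_cst.
  - exact: oner_neq0.
  - by move=> y Uy _ _; rewrite divr1.
by split=> //; exact/gen_openE/(gen_regular_open rf).
Qed.

Lemma gen_spaceP (Z : funSpace k) (h : Z -> gen_space) :
  is_morphism h <->
  forall U f, B U f -> open (h @^-1` U) /\ regular (h @^-1` U) (f \o h).
Proof.
split=> [[ch rh] U f BUf|Bh].
  have [oU rU] := gen_space_section (gen_section_gen BUf).
  by split; [exact: open_comp|exact: rh].
have sh U f : gen_section U f ->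
    open (h @^-1` U) /\ regular (h @^-1` U) (f \o h).
  elim=> {U f} [|c|U V f g _ [oU rU] _ [oV rV]|U V f g _ [oU rU] _ [oV rV]].
  - exact: Bh.
  - by rewrite preimage_setT; split; [|apply: regular_cst]; exact: openT.
  - have oUV : open (h @^-1` (U `&` V)) by rewrite preimage_setI; exact: openI.
    by split=> //; apply: regularD => //; [move: rU|move: rV];
      apply: regular_sub => // x [].
  - have oUV : open (h @^-1` (U `&` V)) by rewrite preimage_setI; exact: openI.
    by split=> //; apply: regularM => //; [move: rU|move: rV];
      apply: regular_sub => // x [].
have oh W : gen_open W -> open (h @^-1` W).
  move=> oW; rewrite openE => x /= /oW[U [f [/sh[oU rU] Ux fx UW]]].
  have oD : open ((h @^-1` U) `&` [set z | (f \o h) z != 0]).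
    exact: regular_open.
  apply: (@filterS _ (nbhs x) _ _ _ _ (open_nbhs_nbhs (conj oD (conj Ux fx)))).
  by move=> z [Uz fz]; exact: UW.
split=> [|W f /gen_openE oW rf]; first by apply/continuousP => W /gen_openE /oh.
apply: regular_glue => x Wx.
have [U [V [p [q [/sh[oU rp] /sh[oV rq] [Ux Vx] qx UVW]]]]] := rf _ Wx.
have oD := regular_open oV rq.
pose D := (h @^-1` U) `&` ((h @^-1` V) `&` [set z | (q \o h) z != 0]).
have oD' : open D by exact: openI.
exists D, (fun z => (p \o h) z * ((q \o h) z)^-1); split=> //.
- by move=> z [Uz [Vz qz]]; have [] := UVW _ Uz Vz qz.
- apply: regularM => //.
  + by apply: regular_sub rp => // z [].
  + by apply: regular_sub (regularV oV rq) => // z [].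
- by move=> z [Uz [Vz qz]]; have [_] := UVW _ Uz Vz qz.
Qed.

End GeneratedSpace.

(* Points of the affine space k^n; the generated sections are the polynomial
   functions, so the closed sets are the algebraic sets. *)
Definition affine_space (k : fieldType) (n : nat) : funSpace k :=
  gen_space (T := 'rV[k]_n)
    (fun U f => exists i, U = setT /\ f = (fun x => x ord0 i)).

(* The induced structure (for A closed: the reduced one). *)
Definition induced_space (k : fieldType) (X : funSpace k) (A : set X) :
    funSpace k :=
  gen_space (T := set_type A)
    (fun U f => exists (V : set X) (g : X -> k), [/\ open V, regular V g,
       U = (fun a : set_type A => V (val a)) & f = (fun a => g (val a))]).

(* The fibre product X^I over k; its points are the maps I -> X. *)
Definition fibre_power (k : fieldType) (I : finType) (X : funSpace k) :
    funSpace k :=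
  gen_space (T := (I -> X))
    (fun U f => exists (i : I) (V : set X) (g : X -> k),
       [/\ open V, regular V g, U = (fun x => V (x i)) &
           f = (fun x => g (x i))]).

Lemma fibre_power_morphism (k : fieldType) (I : finType) (X Z : funSpace k)
    (h : Z -> fibre_power I X) :
  is_morphism h <-> forall i, is_morphism (fun z => (h z : I -> X) i).
Proof.
split=> [/gen_spaceP mh i|mh].
  split=> [|U f oU rU].
    apply/continuousP => U oU.
    have [] // := mh (fun x => U (x i)) (fun=> 0).
    by exists i, U, (fun=> 0); split=> //; exact: regular_cst.
  have [] // := mh (fun x => U (x i)) (fun x => f (x i)).
  by exists i, U, f.
apply/gen_spaceP => U f [i [V [g [oV rV -> ->]]]].
have [ch rh] := mh i; split; last exact: (rh _ _ oV rV).
by move/continuousP: ch; exact.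
Qed.

Definition affine (k : fieldType) (X : funSpace k) : Prop :=
  exists (n : nat) (Z : set (affine_space k n)),
    closed Z /\ isomorphic X (induced_space Z).

Record variety (k : closedFieldType) := Variety {
  variety_space :> funSpace k;
  variety_affine_cover :
    exists (n : nat) (U : 'I_n -> set variety_space),
      (forall i, open (U i) /\ affine (induced_space (U i))) /\
      \bigcup_i U i = setT;
  variety_separated :
    closed [set x : fibre_power bool variety_space |
              (x : bool -> variety_space) true =
              (x : bool -> variety_space) false]
}.

Local Open Scope fset_scope.

Definition finitely_generated (G : groupType) : Prop :=
  exists A : {fset G}, forall S : {pred G},
    group_closed S -> {subset A <= S} -> forall g, g \in S.

Definition hamming (R : realType) (n : nat) (p q : 'S_n) : R :=
  #|[pred i | p i != q i]|%:R / n%:R.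

(* Products of permutations in MathComp apply the left factor first:
   (phi h * phi g) i = phi g (phi h i), i.e. the composite of phi h and then
   phi g. *)
Definition sofic (R : realType) (G : groupType) : Prop :=
  forall (K : {fset G}) (e : R), 0 < e ->
  exists (n : nat) (phi : G -> 'S_n), [/\ (0 < n)%N,
    forall g h, g \in K -> h \in K ->
      hamming R (phi (g * h)%g) (phi h * phi g)%g <= e &
    forall g h, g \in K -> h \in K -> g <> h ->
      1 - e <= hamming R (phi g) (phi h)].

Definition uniformly_bounded_singularity (G : groupType) (S : Type)
    (s : G -> S) : Prop :=
  forall E : {fset G}, 1%g \in E -> [fset (e^-1)%g | e in E] = E ->
  exists2 F : {fset G}, E `<=` F &
    let FE := [fset (f * e)%g | f in F, e in E] in
    forall g h, g \in FE `\` F -> h \in FE `\` F -> s g = s h.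

Definition translate (G : groupType) (T : Type) (g : G) (x : G -> T) : G -> T :=
  fun h => x (g^-1 * h)%g.

Definition sigma (k : closedFieldType) (X : variety k) (G : groupType)
    (M : {fset G}) (s : G -> var_morphism (fibre_power M X) X) (x : G -> X) :
    G -> X :=
  fun g => s g (fun m : M => translate g^-1%g x (val m)).

(* Main.v *)
Require Import Defs.
From mathcomp Require Import all_boot all_order all_algebra all_fingroup.
From mathcomp Require Import finmap.
From mathcomp Require Import boolp classical_sets reals topology.
From mathcomp Require Import zify ring lra.

(** Suppose that sigma s o sigma t = id but that sigma t o sigma s moves some
    x0 at some cell g0.  The argument is a count of the points of X on a finite
    sofic approximation V of G, where numbers of points are replaced by growths
    of spaces of polynomial functions.

    The equation of the composite at a cell g involves s at g alone and t on
    g M.  So, unless G is finite, a shell where t is constant provides a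
    constant solution (a, b) of the equation, and (s, t) can be replaced by a
    pair that is equal to (a, b) off a finite set B ([finite_singularity]).
    Copies of B, around the points of a set W of positive density in V, in a
    constant background, give two morphisms f and g from X^V to itself with
    g (f x) = x on the set Gd of good points, whose complement is negligible
    with respect to W ([sofic_packing], [sigma_on_retract]).  Moreover f x
    satisfies, around each w in W, a closed condition on a bounded block of
    coordinates that not all points satisfy.

    For a finite alphabet, such an f would be too close to an injection for an
    image subject to so many conditions.  For a variety X, let Z_c, c in C, be
    its irreducible components, which are finitely many by the basis theorem.
    The components of X^V are the products of components of X, indexed by the
    maps from V to C, and f sends the component c into some component T c; the
    retraction g makes T injective up to the coordinates outside Gd.  The size
    of Z_c is measured by its growth h_c(N), the dimension of the space of
    functions on an affine chart of Z_c that are polynomials of degree at most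
    N in each coordinate.  Three facts suffice.
    - Growths are multiplicative on products ([rank_prod_ge],
      [rank_prod_le]).
    - The retraction g identifies, up to a common denominator, the functions of
      degree N on the component c with functions of degree D N on the image of
      f, for some constant D ([mrank_retraction]).
    - A nontrivial equation costs a factor N ([mrank_hypersurface]).
    Hence the product of the h_(c v)(N) over Gd, multiplied by N for each w in W
    whose condition does not hold everywhere on the component T c, is at most
    the product of the h_(T c v)(D N) over V ([growth_inequality]).

    At a suitable scale N the passage from N to D N costs only a constant
    factor.  The roots u_c = h_c(N)^(1 / log N) are then weights bounded
    independently of V for which a factor N becomes a factor 2 while constant
    factors disappear; summing the inequalities over all c compares the total
    weight of X^V with itself and gives a contradiction
    ([growth_contradiction]). *)

Set Implicit Arguments.
Unset Strict Implicit.
Unset Printing Implicit Defensive.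

Import Order.TTheory GRing.Theory Num.Theory.
Local Open Scope classical_set_scope.
Local Open Scope ring_scope.

(** * Ranks of finite families of functions *)

Section FunctionRank.
Variable k : fieldType.

Definition free_on T (D : set T) (J : finType) (F : J -> T -> k)
    (B : {set J}) : Prop :=
  forall c : J -> k, (forall z, D z -> \sum_(j in B) c j * F j z = 0) ->
  forall j, j \in B -> c j = 0.

Definition rank_on T (D : set T) (J : finType) (F : J -> T -> k) : nat :=
  \max_(B : {set J} | `[< free_on D F B >]) #|B|.

Lemma kernel_vector (J L : finType) (B : {set J}) (S : {set L})
    (C : J -> L -> k) : (#|S| < #|B|)%N ->
  exists c : J -> k, (exists2 j, j \in B & c j != 0) /\
    forall l, l \in S -> \sum_(j in B) c j * C j l = 0.
Proof.
move=> SB; pose A := \matrix_(i < #|B|, j < #|S|) C (enum_val i) (enum_val j).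
have : kermx A != 0.
  by rewrite kermx_eq0 /row_free neq_ltn (leq_ltn_trans (rank_leq_col A) SB).
case/rowV0Pn => u /sub_kermxP uA /rV0Pn[i0 ui0].
pose c j := \sum_(i < #|B| | enum_val i == j) u 0 i.
have cE i : c (enum_val i) = u 0 i.
  rewrite /c (eq_bigl (pred1 i)) ?big_pred1_eq// => i'.
  by rewrite (inj_eq enum_val_inj).
exists c; split; first by exists (enum_val i0); rewrite ?enum_valP// cE.
move=> l lS; rewrite big_enum_val.
have /matrixP/(_ 0 (enum_rank_in lS l)) := uA; rewrite !mxE => uAl.
rewrite -[RHS]uAl; by apply: eq_bigr => i _; rewrite cE mxE enum_rankK_in.
Qed.

Lemma rank_basis T (D : set T) (J : finType) (F : J -> T -> k) :
  exists B : {set J}, [/\ free_on D F B, #|B| = rank_on D F &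
    forall j, exists c : J -> k, forall z, D z ->
      F j z = \sum_(l in B) c l * F l z].
Proof.
have free0 : `[< free_on D F finset.set0 >] by apply/asboolP => c _ j; rewrite inE.
have frP : (0 < #|[pred B : {set J} | `[< free_on D F B >]]|)%N.
  by apply/card_gt0P; exists finset.set0; exact: free0.
have [B /asboolP frB BE] := eq_bigmax_cond (fun B : {set J} => #|B|) frP.
exists B; split=> [//||j]; first by rewrite -BE.
have [jB|jB] := boolP (j \in B).
  exists (fun l => (l == j)%:R) => z _.
  rewrite (bigD1 j)//= eqxx mul1r big1 ?addr0// => l /andP[_ /negPf->].
  by rewrite mul0r.
have : ~ free_on D F (j |: B).
  move=> fr; have : (#|j |: B| <= #|B|)%N.
    by rewrite -BE; apply: (bigop.bigmax_sup (j |: B)) => //; exact/asboolP.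
  by rewrite cardsU1 jB ltnn.
move/existsNP => [c /not_implyP[c0 /existsNP[j' /not_implyP[j'B /eqP cj']]]].
have cE z : D z -> c j * F j z + \sum_(l in B) c l * F l z = 0.
  by move=> Dz; have := c0 z Dz; rewrite big_setU1.
have cj : c j != 0.
  apply/eqP => cj0; have cB0 l : l \in B -> c l = 0.
    by apply: frB => z /cE; rewrite cj0 mul0r add0r.
  by move: j'B cj'; rewrite !inE => /orP[/eqP->|/cB0->]; rewrite ?cj0 eqxx.
exists (fun l => - (c j)^-1 * c l) => z /cE /eqP.
rewrite addr_eq0 => /eqP cF; apply: (mulfI cj).
rewrite cF mulr_sumr -sumrN; apply: eq_bigr => l _.
by rewrite !mulrA mulrN divff// !mulN1r mulNr.
Qed.

(** This compares ranks along a dominant map psi: the multiplication by u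
    clears the denominators of the pulled back functions, and psi is only
    needed on a part O that is dense for the relations between the H l. *)
Lemma free_card_le T T' (D O : set T) (D' : set T') (L J : finType)
    (H : L -> T -> k) (S : {set L}) (F : J -> T' -> k) (psi : T -> T')
    (u : T -> k) :
  free_on D H S ->
  (forall z, O z -> D' (psi z) /\ u z != 0) ->
  (forall c : L -> k, (forall z, O z -> \sum_(l in S) c l * H l z = 0) ->
     forall z, D z -> \sum_(l in S) c l * H l z = 0) ->
  (forall l, l \in S -> exists c : J -> k, forall z, O z ->
     u z * H l z = \sum_j c j * F j (psi z)) ->
  (#|S| <= rank_on D' F)%N.
Proof.
move=> frS Ou dense uH; have [B [_ <- FB]] := rank_basis D' F.
rewrite leqNgt; apply/negP => BS.
have /choice[c1 Hc1] (l : L) : exists c : J -> k, l \in S -> forall z, O z ->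
    u z * H l z = \sum_j c j * F j (psi z).
  have [/uH[c Hc]|lS] := boolP (l \in S); first by exists c.
  by exists (fun=> 0).
have /choice[c2 Hc2] := FB.
have [c [[l lS cl0] cK]] :=
  kernel_vector (fun l j => \sum_i c1 l i * c2 i j) BS.
have {}frS := frS c; move/eqP: cl0; apply; apply: frS lS; apply: dense => z Oz.
have [D'z uz] := Ou z Oz; apply: (mulfI uz); rewrite mulr0 mulr_sumr.
transitivity (\sum_(l in S) \sum_(j in B)
    (c l * \sum_i c1 l i * c2 i j) * F j (psi z)).
  apply: eq_bigr => l' l'S; rewrite mulrCA Hc1//.
  under eq_bigr do rewrite (Hc2 _ _ D'z) mulr_sumr.
  rewrite exchange_big mulr_sumr; apply: eq_bigr => j _ /=.
  by rewrite -mulrA mulr_suml; congr *%R; apply: eq_bigr => i _; rewrite mulrA.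
rewrite exchange_big big1// => j jB.
by rewrite -mulr_suml cK// mul0r.
Qed.

Lemma free_card_le_span T (D : set T) (L J : finType)
    (H : L -> T -> k) (S : {set L}) (F : J -> T -> k) :
  free_on D H S ->
  (forall l, l \in S -> exists c : J -> k, forall z, D z ->
     H l z = \sum_j c j * F j z) ->
  (#|S| <= rank_on D F)%N.
Proof.
move=> frS HF; apply: (@free_card_le _ _ D D D _ _ H S F id (fun=> 1)) => //.
  by move=> z Dz; split=> //; exact: oner_neq0.
by move=> l /HF[c Hc]; exists c => z Dz; rewrite mul1r Hc.
Qed.

Lemma rank_le_span T (D : set T) (J L : finType) (F : J -> T -> k)
    (S : {set L}) (G : L -> T -> k) :
  (forall j, exists c : L -> k, forall z, D z ->
     F j z = \sum_(l in S) c l * G l z) ->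
  (rank_on D F <= #|S|)%N.
Proof.
move=> /choice[C HC]; have [B [frB <- _]] := rank_basis D F.
rewrite leqNgt; apply/negP => SB.
have [c [[j jB cj0] cK]] := kernel_vector C SB.
have {}frB := frB c; move/eqP: cj0; apply; apply: frB jB => z Dz.
transitivity (\sum_(j in B) \sum_(l in S) (c j * C j l) * G l z).
  apply: eq_bigr => j' _; rewrite HC// mulr_sumr.
  by apply: eq_bigr => l _; rewrite mulrA.
by rewrite exchange_big big1// => l lS; rewrite -mulr_suml cK// mul0r.
Qed.

Lemma rank_le_card T (D : set T) (J : finType) (F : J -> T -> k) :
  (rank_on D F <= #|J|)%N.
Proof. by apply/bigmax_leqP => B _; exact: max_card. Qed.

Lemma rank_le_family T (D : set T) (J L : finType) (F : J -> T -> k)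
    (G : L -> T -> k) :
  (forall j, exists c : L -> k, forall z, D z -> F j z = \sum_l c l * G l z) ->
  (rank_on D F <= rank_on D G)%N.
Proof.
move=> FG; have [B [frB <- _]] := rank_basis D F.
by apply: free_card_le_span frB _ => l _; exact: FG.
Qed.

Lemma rank_subset T (D D' : set T) (J : finType) (F : J -> T -> k) :
  D `<=` D' -> (rank_on D F <= rank_on D' F)%N.
Proof.
move=> DD'; have [B [frB <- _]] := rank_basis D F.
apply: (bigop.bigmax_sup B) => //; apply/asboolP => c c0.
by apply: frB => z /DD'; exact: c0.
Qed.

Lemma rank_gt0 T (D : set T) (J : finType) (F : J -> T -> k) j z :
  D z -> F j z != 0 -> (0 < rank_on D F)%N.
Proof.
move=> Dz Fz; rewrite -(cards1 j).
apply: (bigop.bigmax_sup [set j]%SET) => //; apply/asboolP => c c0 j'.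
rewrite inE => /eqP->; have /eqP := c0 z Dz.
by rewrite big_set1 mulf_eq0 (negPf Fz) orbF => /eqP.
Qed.

Lemma rank_gt0_nonempty T (D : set T) (J : finType) (F : J -> T -> k) :
  (0 < rank_on D F)%N -> exists z, D z.
Proof.
have [B [frB <- _]] := rank_basis D F => /card_gt0P[j jB].
apply/not_existsP => D0; have /eqP := oner_neq0 k; apply.
by apply: (frB (fun=> 1)) jB => z /D0.
Qed.

Section Products.
Variables (V J : finType) (X : Type) (D : V -> set X) (F : V -> J -> X -> k).

Definition prod_family (b : {ffun V -> J}) (y : V -> X) : k :=
  \prod_v F v (b v) (y v).

Lemma free_prod (B : V -> {set J}) (y0 : V -> X) :
  (forall v, D v (y0 v)) -> (forall v, free_on (D v) (F v) (B v)) ->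
  free_on [set y | forall v, D v (y v)] prod_family
    [set b in family (fun v => mem (B v))]%SET.
Proof.
move=> Dy0 frB c c0 b0 b0B.
(* The coefficients are compared one coordinate at a time: the coordinates in
   r have already been frozen to their values in b0. *)
suff strip (r : seq V) y : (forall v, D v (y v)) ->
    \sum_(b in [set b in family (fun v => mem (B v))]%SET |
        all (fun v => b v == b0 v) r)
      c b * \prod_(v | v \notin r) F v (b v) (y v) = 0.
  have := strip (enum V) y0 Dy0; rewrite (big_pred1 b0).
    by rewrite big_pred0 ?mulr1// => v; rewrite mem_enum inE.
  move=> b; apply/andP/eqP => [[_ /allP bb0]|->].
    by apply/ffunP => v; apply/eqP/bb0; rewrite mem_enum.
  by split=> //; apply/allP => v _; exact: eqxx.
elim: r y => [|v r IHr] y Dy.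
  rewrite -[RHS](c0 y Dy); apply: eq_big => [b|b _]; first by rewrite andbT.
  by congr *%R; apply: eq_bigl.
have [vr|vr] := boolP (v \in r).
  rewrite -[RHS](IHr y Dy); apply: eq_big => [b|b _] /=.
    by congr andb; rewrite andb_idl// => /allP/(_ _ vr).
  congr *%R; apply: eq_bigl => v'; rewrite inE negb_or andb_idl//.
  by apply: contraNneq => ->.
pose G l := \sum_(b in [set b in family (fun v => mem (B v))]%SET |
    all (fun v => b v == b0 v) r && (b v == l))
  c b * \prod_(v' | v' \notin v :: r) F v' (b v') (y v').
have : G (b0 v) = 0.
  have := b0B; rewrite inE => /familyP/(_ v); apply: frB => z Dz.
  pose y' v' := if v' == v then z else y v'.
  have Dy' v' : D v' (y' v') by rewrite /y'; case: eqP => [->|_].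
  rewrite -[RHS](IHr y' Dy') (partition_big (fun b : {ffun V -> J} => b v)
    (mem (B v))) /=; last first.
    by move=> b; rewrite inE => /andP[/familyP/(_ v)].
  apply: eq_bigr => l lB; rewrite mulr_suml.
  apply: eq_big => [b|b /and3P[_ _ /eqP <-]]; first by rewrite -andbA.
  rewrite [in RHS](bigD1 v)//= {1}/y' eqxx mulrAC -mulrA; congr *%R; congr *%R.
  apply: eq_big => [v'|v']; first by rewrite inE negb_or andbC.
  by rewrite inE negb_or /y' => /andP[/negPf->].
move=> G0; rewrite -[RHS]G0; apply: eq_bigl => b /=.
by congr andb; rewrite andbC.
Qed.

Lemma card_family_set (B : V -> {set J}) :
  #|[set b : {ffun V -> J} in family (fun v => mem (B v))]%SET| =
  (\prod_v #|B v|)%N.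
Proof.
rewrite cardsE card_family foldrE big_map big_enum /=.
by apply: eq_bigr => v _; apply: eq_card.
Qed.

Lemma rank_prod_ge (y0 : V -> X) : (forall v, D v (y0 v)) ->
  (\prod_v rank_on (D v) (F v)
   <= rank_on [set y | forall v, D v (y v)] prod_family)%N.
Proof.
move=> Dy0; have /choice[B HB] v := rank_basis (D v) (F v).
under eq_bigr => v _ do have [_ <- _] := HB v.
rewrite -card_family_set.
have frP := free_prod Dy0 (fun v => let: And3 fr _ _ := HB v in fr).
by apply: (bigop.bigmax_sup _ _ (leqnn _)); exact/asboolP.
Qed.

Lemma rank_prod_le :
  (rank_on [set y | forall v, D v (y v)] prod_family
   <= \prod_v rank_on (D v) (F v))%N.
Proof.
have /choice[B HB] v := rank_basis (D v) (F v).
under eq_bigr => v _ do have [_ <- _] := HB v.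
rewrite -card_family_set; apply: (rank_le_span (G := prod_family)) => b.
have /choice[C HC] v : exists c : J -> k, forall z, D v z ->
    F v (b v) z = \sum_(l in B v) c l * F v l z by have [_ _] := HB v.
exists (fun b' : {ffun V -> J} => \prod_v C v (b' v)) => y Dy.
rewrite /prod_family; under eq_bigr => v _ do rewrite HC//.
rewrite bigA_distr_big_dep; apply: eq_big => [b'|b' _]; last exact: big_split.
by rewrite inE.
Qed.

End Products.
End FunctionRank.

(** * Polynomial functions in given coordinates *)

Section PolynomialFunctions.
Variable k : fieldType.

Section Coordinates.
Variables (I : finType) (T : Type) (xi : I -> T -> k).

Definition mono (N : nat) (a : {ffun I -> 'I_N.+1}) (z : T) : k :=
  \prod_i xi i z ^+ a i.

(** The degree is bounded in each variable separately, so that the monomials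
    of a product are the products of monomials. *)
Definition pol (N : nat) (f : T -> k) : Prop :=
  exists c : {ffun I -> 'I_N.+1} -> k, forall z, f z = \sum_a c a * mono a z.

Definition mrank (D : set T) (N : nat) : nat := rank_on D (@mono N).

Lemma eq_pol N f g : f =1 g -> pol N f -> pol N g.
Proof. by move=> fg [c Hc]; exists c => z; rewrite -fg Hc. Qed.

Lemma pol_mono N (a : {ffun I -> 'I_N.+1}) : pol N (mono a).
Proof.
exists (fun b => (b == a)%:R) => z.
rewrite (bigD1 a)//= eqxx mul1r big1 ?addr0// => b /negPf->.
by rewrite mul0r.
Qed.

Lemma polZ N c f : pol N f -> pol N (fun z => c * f z).
Proof.
move=> [d Hd]; exists (fun a => c * d a) => z; rewrite Hd mulr_sumr.
by apply: eq_bigr => a _; rewrite mulrA.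
Qed.

Lemma polD N f g : pol N f -> pol N g -> pol N (fun z => f z + g z).
Proof.
move=> [d Hd] [e He]; exists (fun a => d a + e a) => z.
by rewrite Hd He -big_split; apply: eq_bigr => a _; rewrite mulrDl.
Qed.

Lemma pol_sum N (L : Type) (r : seq L) (P : pred L) (F : L -> T -> k) :
  (forall l, P l -> pol N (F l)) -> pol N (fun z => \sum_(l <- r | P l) F l z).
Proof.
move=> polF; elim: r => [|l r IHr].
  exists (fun=> 0) => z; rewrite big_nil big1// => a _; exact: mul0r.
case Pl: (P l); last by apply: eq_pol IHr => z; rewrite big_cons Pl.
by apply: eq_pol (polD (polF l Pl) IHr) => z; rewrite big_cons Pl.
Qed.

Lemma pol_expn N (e : I -> nat) : (forall i, e i <= N)%N ->
  pol N (fun z => \prod_i xi i z ^+ e i).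
Proof.
move=> eN; apply: eq_pol (pol_mono [ffun i => inord (e i)]) => z.
by apply: eq_bigr => i _; rewrite ffunE inordK// ltnS.
Qed.

Lemma pol_cst N c : pol N (fun=> c).
Proof.
have := polZ c (@pol_expn N (fun=> 0%N) (fun=> leq0n N)); apply: eq_pol => z.
by rewrite big1 ?mulr1// => i _; rewrite expr0.
Qed.

Lemma pol_coord N i : (0 < N)%N -> pol N (xi i).
Proof.
move=> N0; have := @pol_expn N (fun j => (j == i) : nat).
have H j : ((j == i) <= N)%N by case: eqP.
move=> /(_ H); apply: eq_pol => z; rewrite (bigD1 i)//= eqxx expr1.
by rewrite big1 ?mulr1// => j /negPf->.
Qed.

Lemma polM N N' f g : pol N f -> pol N' g ->
  pol (N + N') (fun z => f z * g z).
Proof.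
move=> [c Hc] [d Hd].
have : pol (N + N') (fun z => \sum_a \sum_b (c a * d b) * (mono a z * mono b z)).
  apply: pol_sum => a _; apply: pol_sum => b _; apply: polZ.
  have H i : (a i + b i <= N + N')%N by rewrite leq_add// -ltnS.
  apply: eq_pol (pol_expn H) => z; rewrite /mono -big_split.
  by apply: eq_bigr => i _; rewrite exprD.
apply: eq_pol => z; rewrite Hc Hd mulr_suml; apply: eq_bigr => a _.
by rewrite mulr_sumr; apply: eq_bigr => b _; rewrite mulrACA.
Qed.

Lemma pol_le N N' f : (N <= N')%N -> pol N f -> pol N' f.
Proof.
move=> NN' /polM/(_ (pol_cst (N' - N) 1)); rewrite subnKC//.
by apply: eq_pol => z; rewrite mulr1.
Qed.

Lemma pol_exp N f m : pol N f -> pol (N * m) (fun z => f z ^+ m).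
Proof.
move=> pf; elim: m => [|m IHm]; first exact: pol_cst.
by rewrite mulnS; apply: eq_pol (polM pf IHm) => z; rewrite exprS.
Qed.

Lemma pol_prod (L : finType) (P : pred L) N (F : L -> T -> k) :
  (forall l, P l -> pol N (F l)) ->
  pol (#|L| * N) (fun z => \prod_(l | P l) F l z).
Proof.
move=> polF.
suff H r : pol (size r * N) (fun z => \prod_(l <- r | P l) F l z).
  have := H (enum L); rewrite -cardE; apply: eq_pol => z.
  by rewrite big_enum_cond.
elim: r => [|l r IHr].
  by apply: eq_pol (pol_cst _ 1) => z; rewrite big_nil.
rewrite mulSn; case Pl: (P l).
  by apply: eq_pol (polM (polF l Pl) IHr) => z; rewrite big_cons Pl.
by apply: eq_pol (pol_le (leq_addl _ _) IHr) => z; rewrite big_cons Pl.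
Qed.

Lemma mrank_mono D N N' : (N <= N')%N -> (mrank D N <= mrank D N')%N.
Proof.
move=> NN'; apply: rank_le_family => a.
by have [c Hc] := pol_le NN' (pol_mono a); exists c => z _; exact: Hc.
Qed.

Lemma mrank_le D N : (mrank D N <= N.+1 ^ #|I|)%N.
Proof. by rewrite (leq_trans (rank_le_card _ _))// card_ffun card_ord. Qed.

Lemma mrank_gt0 D N z : D z -> (0 < mrank D N)%N.
Proof.
move=> Dz; apply: (@rank_gt0 _ _ _ _ _ [ffun=> ord0] z) => //.
by rewrite /mono big1 ?oner_neq0// => i _; rewrite ffunE expr0.
Qed.

(** Cutting D by an equation phi = 0, where phi is not a zero divisor on D,
    divides the growth of the rank by a linear factor.  Indeed, polynomials
    that are linearly independent where phi vanishes stay so after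
    multiplication by 1, phi, ..., phi ^ N: in a relation between the products
    the coefficient of the lowest power of phi vanishes with phi, and then phi
    can be divided out. *)
Lemma mrank_hypersurface (D D' : set T) (phi : T -> k) e N :
  D' `<=` D -> (forall z, D' z -> phi z = 0) -> pol e phi ->
  (forall M f, pol M f -> (forall z, D z -> phi z * f z = 0) ->
     forall z, D z -> f z = 0) ->
  (N.+1 * mrank D' N <= mrank D (e * N + N))%N.
Proof.
move=> D'D phi0 pphi reg; rewrite /mrank.
have [B [frB <- _]] := rank_basis D' (@mono N).
pose H (l : 'I_N.+1 * {ffun I -> 'I_N.+1}) z := phi z ^+ l.1 * mono l.2 z.
have -> : (N.+1 * #|B| = #|finset.setX [set: 'I_N.+1]%SET B|)%N.
  by rewrite cardsX cardsT card_ord.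
apply: (free_card_le_span (H := H)); last first.
  move=> l _; have pl : (l.1 <= N)%N by rewrite -ltnS.
  have := polM (pol_exp l.1 pphi) (pol_mono l.2).
  move=> /(pol_le (N' := (e * N + N)%N)) [|c Hc].
    by rewrite leq_add2r leq_mul2l pl orbT.
  by exists c => z _; rewrite -Hc.
move=> c c0.
pose P i z := \sum_(b in B) c (i, b) * mono b z.
have polP i : pol N (P i).
  by apply: pol_sum => b _; apply: polZ; exact: pol_mono.
have HP z : \sum_(l in finset.setX [set: 'I_N.+1]%SET B) c l * H l z =
    \sum_(i < N.+1) phi z ^+ i * P i z.
  transitivity (\sum_(i in [set: 'I_N.+1]%SET) \sum_(b in B)
      c (i, b) * (phi z ^+ i * mono b z)).
    by rewrite pair_big; apply: eq_big => [[i b]|[i b] _] //; rewrite inE.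
  apply: eq_big => [i|i _]; first by rewrite inE.
  by rewrite mulr_sumr; apply: eq_bigr => b _; rewrite mulrCA.
have Pz m (Q : nat -> T -> k) : (forall i, pol N (Q i)) ->
    (forall i, (forall z, D' z -> Q i z = 0) -> forall z, Q i z = 0) ->
    (forall z, D z -> \sum_(i < m) phi z ^+ i * Q i z = 0) ->
    forall i, (i < m)%N -> forall z, Q i z = 0.
  elim: m Q => [//|m IHm] Q polQ Q0 sQ.
  have Q00 : forall z, Q 0%N z = 0.
    apply: Q0 => z D'z; have := sQ z (D'D _ D'z).
    rewrite big_ord_recl big1 ?addr0 ?expr0 ?mul1r// => i _.
    by rewrite phi0// exprS mul0r mul0r.
  case=> [//|i] im; apply: (IHm (fun i => Q i.+1) (fun i => polQ i.+1) (fun i => Q0 i.+1)) => //.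
  have polS : pol (e * m + N) (fun z => \sum_(i < m) phi z ^+ i * Q i.+1 z).
    apply: pol_sum => j _.
    apply: (pol_le _ (polM (pol_exp j pphi) (polQ j.+1))).
    by rewrite leq_add2r leq_mul2l ltnW ?orbT.
  apply: (reg _ _ polS) => z Dz; rewrite -[RHS](sQ z Dz) big_ord_recl Q00.
  rewrite mulr0 add0r mulr_sumr; apply: eq_bigr => j _.
  by rewrite exprS mulrA.
have P0 (i : 'I_N.+1) z : P i z = 0.
  pose Q j := P (inord j).
  have := Pz N.+1 Q (fun j => polP _) _ _ i (ltn_ord i) z.
  rewrite /Q inord_val; apply=> [j Pj z'|z' Dz'].
    rewrite /P big1// => b bB; rewrite (frB (fun b => c (inord j, b)))// ?mul0r//.
  rewrite -[RHS](c0 _ Dz') HP; apply: eq_bigr => j _.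
  by rewrite inord_val.
move=> [i b]; rewrite inE => /andP[_ /= bB].
by apply: (frB (fun b => c (i, b))) bB => z _; exact: P0.
Qed.

End Coordinates.

Lemma pol_subst (I I' : finType) (T T' : Type) (xi : I -> T -> k)
    (xi' : I' -> T' -> k) (rho : T' -> T) N f :
  (forall i, exists e, pol xi' e (xi i \o rho)) ->
  pol xi N f -> exists e, pol xi' e (f \o rho).
Proof.
move=> /choice[e He] [c Hc]; pose E := (\max_i e i)%N.
exists (#|I| * (E * N))%N.
apply: (@eq_pol _ _ _ _ (fun z => \sum_a c a * mono xi a (rho z))).
  by move=> z; rewrite /= Hc.
apply: pol_sum => a _; apply: polZ; apply: pol_prod => i _.
apply: (pol_le _ (pol_exp (a i) (He i))).
by rewrite leq_mul ?(leq_bigmax i)// -ltnS.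
Qed.

(** A product of charts has as coordinates the coordinates of the factors, so
    its monomials are the products of monomials of the factors. *)
Definition prod_coord (V I : finType) (X : Type) (xi : V -> I -> X -> k)
  (vi : V * I) (y : V -> X) : k := xi vi.1 vi.2 (y vi.1).

Lemma mrank_prod_le (V I : finType) (X : Type) (xi : V -> I -> X -> k)
    (D : V -> set X) N :
  (mrank (prod_coord xi) [set y | forall v, D v (y v)] N
   <= \prod_v mrank (xi v) (D v) N)%N.
Proof.
apply: leq_trans (rank_prod_le _ _); apply: rank_le_family => a.
pose b : {ffun V -> {ffun I -> 'I_N.+1}} := [ffun v => [ffun i => a (v, i)]].
exists (fun b' => (b' == b)%:R) => y _.
rewrite (bigD1 b)//= eqxx mul1r big1 ?addr0; last first.
  by move=> b' /negPf->; rewrite mul0r.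
rewrite /mono /prod_family /mono (eq_bigr (fun vi : V * I =>
  xi vi.1 vi.2 (y vi.1) ^+ a (vi.1, vi.2))); last by case.
rewrite -(pair_big predT predT (fun v i => xi v i (y v) ^+ a (v, i))) /=.
by apply: eq_bigr => v _; apply: eq_bigr => i _; rewrite !ffunE.
Qed.

End PolynomialFunctions.

(** * Irreducible sets *)

Definition irreducible_set (T : topologicalType) (A : set T) : Prop :=
  A !=set0 /\ forall O1 O2 : set T, open O1 -> open O2 ->
    A `&` O1 !=set0 -> A `&` O2 !=set0 -> A `&` (O1 `&` O2) !=set0.

Section Irreducible.
Implicit Types T : topologicalType.

Lemma irreducible_image T T' (h : T -> T') (A : set T) :
  continuous h -> irreducible_set A -> irreducible_set (h @` A).
Proof.
move=> /continuousP ch [[a Aa] irA]; split; first by exists (h a), a.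
move=> O1 O2 /ch oO1 /ch oO2 [_ [[x Ax <-] O1x]] [_ [[y Ay <-] O2y]].
have [] := irA _ _ oO1 oO2; [by exists x|by exists y|].
by move=> z [Az [O1z O2z]]; exists (h z); split=> //; exists z.
Qed.

Lemma irreducible_setI_open T (A O : set T) :
  open O -> A `&` O !=set0 -> irreducible_set A -> irreducible_set (A `&` O).
Proof.
move=> oO AO [_ irA]; split=> // O1 O2 oO1 oO2 [x [[Ax Ox] O1x]] [y [[Ay Oy] O2y]].
have [] := irA (O `&` O1) (O `&` O2) (openI oO oO1) (openI oO oO2).
- by exists x.
- by exists y.
- by move=> z [Az [[Oz O1z] [_ O2z]]]; exists z.
Qed.

Lemma irreducible_closure T (A : set T) :
  irreducible_set A -> irreducible_set (closure A).
Proof.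
move=> [[a Aa] irA].
have meet (O : set T) : open O -> closure A `&` O !=set0 -> A `&` O !=set0.
  by move=> oO [x [Ax Ox]]; apply: Ax; exact: open_nbhs_nbhs.
split; first by exists a; exact: subset_closure.
move=> O1 O2 oO1 oO2 /(meet _ oO1) m1 /(meet _ oO2) m2.
have [x [Ax Ox]] := irA _ _ oO1 oO2 m1 m2.
by exists x; split=> //; exact: subset_closure.
Qed.

Lemma irreducible_sub_closed T (C : finType) (Z : C -> set T) (A : set T) :
  irreducible_set A -> (forall c, closed (Z c)) ->
  (forall x, A x -> exists c, Z c x) -> exists c, A `<=` Z c.
Proof.
move=> [[a Aa] irA] cZ AZ; apply: contrapT => /forallNP AnZ.
suff H (r : seq C) : exists2 x, A x & forall c, c \in r -> ~ Z c x.
  have [x Ax Zx] := H (enum C).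
  by have [c Zcx] := AZ x Ax; apply: (Zx c) Zcx; rewrite mem_enum.
suff [O [oO [x [Ax Ox]] OZ]] : exists O : set T, [/\ open O, A `&` O !=set0 &
    forall x, O x -> forall c, c \in r -> ~ Z c x].
  by exists x => //; exact: OZ.
elim: r => [|c r [O [oO AO OZ]]].
  by exists setT; split=> //; [exact: openT|exists a].
have := AnZ c => /existsNP[x /not_implyP[Ax nZx]].
exists (O `&` ~` Z c); have oZ := closed_openC (cZ c); split.
- exact: openI.
- by apply: irA => //; exists x.
- move=> y [Oy nZy] c'; rewrite inE => /predU1P[->//|]; exact: OZ.
Qed.

End Irreducible.

Section FibrePower.
Variables (k : fieldType) (V : finType) (X : funSpace k).

Lemma is_morphism_comp (Y Z W : funSpace k) (g : Z -> W) (h : Y -> Z) :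
  is_morphism g -> is_morphism h -> is_morphism (g \o h).
Proof.
move=> [cg rg] [ch rh]; split=> [x|U f oU rU].
  by apply: continuous_comp; [exact: ch|exact: cg].
have oU' : open (g @^-1` U) by move/continuousP: cg; exact.
exact: (rh _ _ oU' (rg _ _ oU rU)).
Qed.

Lemma is_morphism_id (Y : funSpace k) : is_morphism (@id Y).
Proof. by split=> [x|//]; exact: cvg_id. Qed.

Lemma is_morphism_cst (Y Z : funSpace k) (z : Z) :
  is_morphism (fun _ : Y => z).
Proof.
split=> [x|U f oU rU]; first exact: cst_continuous.
have oU' : open ((fun _ : Y => z) @^-1` U).
  by have /continuousP := @cst_continuous Y Z z; exact.
exact: (regular_cst (f z) oU').
Qed.

Lemma is_morphism_proj (v : V) :
  is_morphism (fun y : fibre_power V X => (y : V -> X) v).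
Proof. exact: (fibre_power_morphism (X := X) id).1 (is_morphism_id _) v. Qed.

Lemma open_box (U : V -> set X) : (forall v, open (U v)) ->
  open ([set y | forall v, U v (y v)] : set (fibre_power V X)).
Proof.
move=> oU; suff H (r : seq V) :
    open ([set y | forall v, v \in r -> U v (y v)] : set (fibre_power V X)).
  rewrite (_ : [set _ | _] = [set y | forall v, v \in enum V -> U v (y v)])//.
  apply/seteqP; split=> y Uy v => [_|]; first exact: Uy.
  by apply: Uy; rewrite mem_enum.
elim: r => [|v r IHr].
  by rewrite (_ : [set _ | _] = setT) -?subTset//; exact: openT.
rewrite (_ : [set _ | _] = [set y : V -> X | U v (y v)] `&`
    [set y | forall v, v \in r -> U v (y v)]).
  by apply: openI => //; have [/continuousP + _] := is_morphism_proj v; apply.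
apply/seteqP; split=> y => [Uy|[Uvy Uy] v'].
  by split=> [|v' v'r]; apply: Uy; rewrite inE ?eqxx ?v'r ?orbT.
by rewrite inE => /predU1P[->//|]; exact: Uy.
Qed.

Definition set_coord (y : V -> X) (v : V) (z : X) : V -> X :=
  fun v' => if v' == v then z else y v'.

Lemma set_coord_continuous (y : V -> X) v :
  continuous (set_coord y v : X -> fibre_power V X).
Proof.
suff [] : is_morphism (set_coord y v : X -> fibre_power V X) by [].
apply/fibre_power_morphism => v'; rewrite /set_coord; case: eqP => _.
  exact: is_morphism_id.
exact: is_morphism_cst.
Qed.

(** Two points in given open sets are made equal one coordinate at a time:
    the two slices through them in one coordinate are open and meet. *)
Lemma irreducible_box (Z : V -> set X) : (forall v, irreducible_set (Z v)) ->
  irreducible_set ([set y | forall v, Z v (y v)] : set (fibre_power V X)).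
Proof.
move=> irZ; split.
  have /choice[y Hy] v : exists x, Z v x by have [] := irZ v.
  by exists y.
move=> O1 O2 oO1 oO2 [a [Za Oa]] [b [Zb Ob]].
suff H (r : seq V) : exists a' b' : V -> X, [/\ forall v, Z v (a' v),
    forall v, Z v (b' v), O1 a', O2 b' & forall v, v \in r -> a' v = b' v].
  have [a' [b' [Za' _ Oa' Ob' ab]]] := H (enum V).
  have ab' : a' = b' by apply/funext => v; apply: ab; rewrite mem_enum.
  by exists a'; split=> //; split=> //; rewrite ab'.
elim: r => [|v r [a' [b' [Za' Zb' Oa' Ob' ab]]]]; first by exists a, b.
have slice (O : set (fibre_power V X)) (y : V -> X) : open O ->
    open (set_coord y v @^-1` O).
  by have /continuousP := @set_coord_continuous y v; exact.
have set_coord_id (y : V -> X) : set_coord y v (y v) = y.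
  by apply/funext => v'; rewrite /set_coord; case: eqP => [->|].
have [_ irZv] := irZ v.
have [z [Zz [Oz1 Oz2]]] := irZv _ _ (slice _ a' oO1) (slice _ b' oO2)
  (ltac:(by exists (a' v); rewrite /preimage /= set_coord_id))
  (ltac:(by exists (b' v); rewrite /preimage /= set_coord_id)).
exists (set_coord a' v z), (set_coord b' v z); split=> //.
- by move=> v'; rewrite /set_coord; case: eqP => [->|].
- by move=> v'; rewrite /set_coord; case: eqP => [->|].
- move=> v'; rewrite /set_coord inE; case: eqP => //= _; exact: ab.
Qed.

End FibrePower.

(** * Charts *)

Section Charts.
Variable k : fieldType.

(** Only the points of D count, so that the notion applies both to a whole
    affine space and to a chart inside a larger space.  With h = 0 it says
    that the nonvanishing loci of polynomials form a basis of open sets of D. *)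
Definition quotient_at (I : finType) T (xi : I -> T -> k) (D W : set T)
    (h : T -> k) (z : T) : Prop :=
  exists P Q, [/\ exists N, pol xi N P, exists N, pol xi N Q, Q z != 0 &
    forall y, D y -> Q y != 0 -> W y /\ h y * Q y = P y].

Section GeneratedQuotients.
Variables (I : finType) (T : choiceType) (B : set T -> (T -> k) -> Prop).
Variables (xi : I -> T -> k) (D : set T).
Hypothesis quotient_gen : forall U f z, B U f -> D z -> U z ->
  quotient_at xi D U f z.

Lemma gen_section_quotient U f z : gen_section B U f -> D z -> U z ->
  quotient_at xi D U f z.
Proof.
move=> sf; elim: sf z => {U f} [U f /quotient_gen H z|c z Dz _||].
- exact: H.
- exists (fun=> c), (fun=> 1); split; last by move=> y; rewrite mulr1.
  + by exists 0%N; exact: pol_cst.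
  + by exists 0%N; exact: pol_cst.
  + exact: oner_neq0.
- move=> U V f g _ IHf _ IHg z Dz [Uz Vz].
  have [P [Q [[N pP] [N' pQ] Qz HQ]]] := IHf z Dz Uz.
  have [P' [Q' [[M pP'] [M' pQ'] Qz' HQ']]] := IHg z Dz Vz.
  exists (fun z => P z * Q' z + P' z * Q z), (fun z => Q z * Q' z); split.
  + exists ((N + M') + (M + N'))%N; apply: polD.
      exact: pol_le (leq_addr _ _) (polM pP pQ').
    exact: pol_le (leq_addl _ _) (polM pP' pQ).
  + by exists (N' + M')%N; exact: polM.
  + exact: mulf_neq0.
  + move=> y Dy; rewrite mulf_eq0 negb_or => /andP[Qy Qy'].
    have [Uy fy] := HQ y Dy Qy; have [Vy gy] := HQ' y Dy Qy'; split=> //.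
    by rewrite mulrDl mulrA fy mulrCA gy [Q y * _]mulrC.
- move=> U V f g _ IHf _ IHg z Dz [Uz Vz].
  have [P [Q [[N pP] [N' pQ] Qz HQ]]] := IHf z Dz Uz.
  have [P' [Q' [[M pP'] [M' pQ'] Qz' HQ']]] := IHg z Dz Vz.
  exists (fun z => P z * P' z), (fun z => Q z * Q' z); split.
  + by exists (N + M)%N; exact: polM.
  + by exists (N' + M')%N; exact: polM.
  + exact: mulf_neq0.
  + move=> y Dy; rewrite mulf_eq0 negb_or => /andP[Qy Qy'].
    have [Uy fy] := HQ y Dy Qy; have [Vy gy] := HQ' y Dy Qy'; split=> //.
    by rewrite mulrACA fy gy.
Qed.

Lemma gen_regular_quotient W h z : gen_regular B W h -> D z -> W z ->
  quotient_at xi D W h z.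
Proof.
move=> rh Dz /rh[U [V [f [g [sf sg [Uz Vz] gz fg]]]]].
have [P [Q [[N pP] [N' pQ] Qz HQ]]] := gen_section_quotient sf Dz Uz.
have [P' [Q' [[M pP'] [M' pQ'] Qz' HQ']]] := gen_section_quotient sg Dz Vz.
exists (fun z => P z * Q' z * (P' z * Q' z)), (fun z => Q z * P' z * (P' z * Q' z)).
have P'z : P' z != 0 by have [_ <-] := HQ' z Dz Qz'; rewrite mulf_neq0.
split.
- by exists ((N + M') + (M + M'))%N; do 2!apply: polM.
- by exists ((N' + M) + (M + M'))%N; do 2!apply: polM.
- by rewrite !mulf_neq0.
- move=> y Dy; rewrite !mulf_eq0 !negb_or => /andP[/andP[Qy Py'] /andP[_ Qy']].
  have [Uy fy] := HQ y Dy Qy; have [Vy gy] := HQ' y Dy Qy'.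
  have gy0 : g y != 0.
    by apply: contraNneq Py' => g0; rewrite -gy g0 mul0r.
  have [Wy ->] := fg y Uy Vy gy0; split=> //.
  rewrite mulrA; congr *%R; rewrite -gy -fy.
  by rewrite [Q y * _]mulrCA [LHS]mulrA divfK// mulrA.
Qed.

End GeneratedQuotients.

(** An affine open set is used only through these properties of its
    coordinates, which pass to finite products. *)
Definition chart (X : funSpace k) (U : set X) (I : finType)
    (xi : I -> X -> k) : Prop :=
  [/\ open U, forall i, regular U (xi i) &
      forall W h z, open W -> regular W h -> U z -> W z ->
        quotient_at xi U W h z].

Lemma chart_regular (X : funSpace k) (U : set X) (I : finType)
    (xi : I -> X -> k) N f : chart U xi -> pol xi N f -> regular U f.
Proof.
move=> [oU rxi _] [c Hc].
rewrite (_ : f = fun z => \sum_(a <- enum {ffun I -> 'I_N.+1}) c a * mono xi a z).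
  elim: (enum _) => [|a r IHr].
    rewrite (_ : (fun _ => _) = fun=> 0); first exact: regular_cst.
    by apply/funext => z; rewrite big_nil.
  rewrite (_ : (fun _ => _) = fun z => (fun z => c a * mono xi a z) z +
    (fun z => \sum_(b <- r) c b * mono xi b z) z).
    apply: regularD => //; apply: regularM => //; first exact: regular_cst.
    rewrite (_ : mono xi a = fun z => \prod_(i <- enum I) xi i z ^+ a i).
      elim: (enum I) => [|i s IHs].
        rewrite (_ : (fun _ => _) = fun=> 1); first exact: regular_cst.
        by apply/funext => z; rewrite big_nil.
      rewrite (_ : (fun _ => _) = fun z => (fun z => xi i z ^+ a i) z *
        (fun z => \prod_(j <- s) xi j z ^+ a j) z).
        apply: regularM => //; elim: (nat_of_ord (a i)) => [|m IHm].
          by rewrite (_ : (fun _ => _) = fun=> 1) //; exact: regular_cst.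
        rewrite (_ : (fun _ => _) = fun z => xi i z * (fun z => xi i z ^+ m) z).
          exact: regularM.
        by apply/funext => z; rewrite exprS.
      by apply/funext => z; rewrite big_cons.
    by apply/funext => z; rewrite /mono big_enum.
  by apply/funext => z; rewrite big_cons.
by apply/funext => z; rewrite Hc big_enum.
Qed.

Lemma chart_open (X : funSpace k) (U : set X) (I : finType)
    (xi : I -> X -> k) N f : chart U xi -> pol xi N f ->
  open (U `&` [set z | f z != 0]).
Proof.
by move=> cU /(chart_regular cU); apply: regular_open; case: cU.
Qed.

Lemma chart_nonzerodivisor (X : funSpace k) (U A : set X) (I : finType)
    (xi : I -> X -> k) N M f g z0 : chart U xi -> irreducible_set A ->
  A `<=` U -> pol xi N f -> pol xi M g -> A z0 -> f z0 != 0 ->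
  (forall z, A z -> f z * g z = 0) -> forall z, A z -> g z = 0.
Proof.
move=> cU [_ irA] AU pf pg Az0 fz0 fg0 z Az; apply/eqP/negP => /negP gz.
have [] := irA _ _ (chart_open cU pf) (chart_open cU pg).
- by exists z0; split=> //; split=> //; exact: AU.
- by exists z; split=> //; split=> //; exact: AU.
move=> y [Ay [[_ fy] [_ gy]]]; have /eqP := fg0 y Ay.
by rewrite mulf_eq0; apply/negP; rewrite negb_or fy gy.
Qed.

Lemma chart_dense (X : funSpace k) (U A O : set X) (I : finType)
    (xi : I -> X -> k) N f : chart U xi -> irreducible_set A ->
  A `<=` U -> pol xi N f -> open O -> A `&` O !=set0 ->
  (forall z, A z -> O z -> f z = 0) -> forall z, A z -> f z = 0.
Proof.
move=> cU [_ irA] AU pf oO AO f0 z Az; apply/eqP/negP => /negP fz.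
have [] := irA _ _ oO (chart_open cU pf) AO.
  by exists z; split=> //; split=> //; exact: AU.
by move=> y [Ay [Oy [_ /=]]]; rewrite f0// eqxx.
Qed.

Lemma chart_closed (X : funSpace k) (U Z : set X) (I : finType)
    (xi : I -> X -> k) z : chart U xi -> closed Z -> U z -> ~ Z z ->
  exists N f, [/\ pol xi N f, f z != 0 &
    forall y, U y -> Z y -> f y = 0].
Proof.
move=> [_ _ loc] cZ Uz nZz; have oZ := closed_openC cZ.
have [P [Q [_ [N pQ] Qz HQ]]] := loc _ _ z oZ (regular_cst 0 oZ) Uz nZz.
exists N, Q; split=> // y Uy Zy; apply/eqP/negP => /negP Qy.
by have [] := HQ y Uy Qy.
Qed.

Lemma chart_box (V : finType) (X : funSpace k) (U : V -> set X) (I : finType)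
    (xi : V -> I -> X -> k) : (forall v, chart (U v) (xi v)) ->
  chart ([set y | forall v, U v (y v)] : set (fibre_power V X)) (prod_coord xi).
Proof.
move=> cU; have oU := open_box (fun v => let: And3 oU _ _ := cU v in oU).
split=> // [[v i]|W h z oW rW Uz Wz].
  have [oUv rxi _] := cU v.
  have [oU' r] : open ([set y | U v (y v)] : set (fibre_power V X)) /\
      regular ([set y | U v (y v)] : set (fibre_power V X)) (fun y : V -> X => xi v i (y v)).
    by apply: gen_space_section; apply: gen_section_gen; exists v, (U v), (xi v i).
  by apply: regular_sub r => // y /(_ v).
apply: gen_regular_quotient rW Uz Wz => _ _ y [v [W' [g [oW' rg -> ->]]]] Uy W'y.
have [_ _ loc] := cU v.
have [P [Q [[N pP] [M pQ] Qy HQ]]] := loc _ _ _ oW' rg (Uy v) W'y.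
have subst N' f : pol (xi v) N' f ->
    exists e, pol (prod_coord xi) e (fun y : V -> X => f (y v)).
  move=> pf; apply: (pol_subst (rho := fun y : V -> X => y v) _ pf) => i.
  by exists 1%N; apply: (pol_coord (prod_coord xi) (v, i)).
exists (fun y => P (y v)), (fun y => Q (y v)); split=> //.
- exact: subst pP.
- exact: subst pQ.
- by move=> y' Uy' Qy'; exact: HQ.
Qed.

Section AffineChart.
Variables (X : funSpace k) (U : set X) (oU : open U).

Lemma induced_section A f : gen_section
    (fun (W : set (set_type U)) (f : set_type U -> k) =>
       exists (V : set X) (g : X -> k), [/\ open V, regular V g,
       W = (fun a : set_type U => V (val a)) & f = (fun a => g (val a))]) A f ->
  exists V g, [/\ open V, regular V g, A = (fun a : set_type U => V (val a)) &
    f = (fun a => g (val a))].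
Proof.
elim=> {A f} [//|c||].
- by exists setT, (fun=> c); split=> //; [exact: openT|apply: regular_cst; exact: openT].
- move=> _ _ _ _ _ [V1 [g1 [oV1 r1 -> ->]]] _ [V2 [g2 [oV2 r2 -> ->]]].
  exists (V1 `&` V2), (fun x => g1 x + g2 x); have oV := openI oV1 oV2.
  split=> //; apply: regularD => //.
    by apply: regular_sub r1 => // x [].
  by apply: regular_sub r2 => // x [].
- move=> _ _ _ _ _ [V1 [g1 [oV1 r1 -> ->]]] _ [V2 [g2 [oV2 r2 -> ->]]].
  exists (V1 `&` V2), (fun x => g1 x * g2 x); have oV := openI oV1 oV2.
  split=> //; apply: regularM => //.
    by apply: regular_sub r1 => // x [].
  by apply: regular_sub r2 => // x [].
Qed.

Lemma set_type_val (x : X) : U x -> exists a : set_type U, val a = x.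
Proof. by move=> Ux; exists (SigSub (mem_set Ux)). Qed.

Lemma induced_regular (F : X -> k) :
  regular (setT : set (induced_space U)) (fun a : set_type U => F (val a)) ->
  regular U F.
Proof.
move=> rF; apply: regular_glue => _ /set_type_val[a <-].
have [A [A' [f [g [sf sg [Aa A'a] ga HF]]]]] := rF a I.
have [V1 [g1 [oV1 r1 A1 f1]]] := induced_section sf.
have [V2 [g2 [oV2 r2 A2 f2]]] := induced_section sg.
rewrite {}A1 {}f1 {}A2 {}f2 in Aa A'a ga HF; rewrite {sf sg}.
have oD := regular_open oV2 r2; have oW := openI (openI oU oV1) oD.
exists (U `&` V1 `&` (V2 `&` [set x | g2 x != 0])), (fun x => g1 x * (g2 x)^-1).
split=> //.
- by split; split=> //; exact/set_mem/valP.
- by move=> x [[]].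
- apply: regularM => //; first by apply: regular_sub r1 => // x [[]].
  by apply: regular_sub (regularV oV2 r2) => // x [].
- by move=> _ [[/set_type_val[b <-] V1b] [V2b gb]]; have [] := HF b V1b V2b gb.
Qed.

Lemma affine_chart : affine (induced_space U) ->
  exists (n : nat) (xi : 'I_n -> X -> k), chart U xi.
Proof.
have [[x0 /set_type_val[a0 _]]|/set0P/negP/negPn/eqP U0] := pselect (U !=set0); last first.
  move=> _; exists 0%N, (fun=> fun=> 0); split=> // [[]//|W h z _ _].
  by rewrite U0.
move=> [n [Z [_ [phi [psi [phiK psiK]]]]]].
pose co (i : 'I_n) (b : set_type Z) : k := (val b : 'rV[k]_n) ord0 i.
pose rho (x : X) : set_type Z := phi (odflt a0 (insub x)).
have rhoE a : rho (val a) = phi a by rewrite /rho valK.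
exists n, (fun i => co i \o rho); split=> // [i|W h z oW rW].
  apply: induced_regular.
  rewrite (_ : (fun a => _) = co i \o phi); last first.
    by apply/funext => a /=; rewrite rhoE.
  have [_ rphi] := mor_morphism phi; apply: (rphi setT); first exact: openT.
  have [|_] := @gen_space_section k (set_type Z) (fun W f =>
    exists (V : set (affine_space k n)) (g : affine_space k n -> k),
    [/\ open V, regular V g, W = (fun a : set_type Z => V (val a)) &
    f = (fun a => g (val a))]) setT (co i); last by [].
  apply: gen_section_gen; exists setT, (fun x : 'rV[k]_n => x ord0 i).
  split=> //; first exact: openT.
  by have [] := @gen_space_section k _ (fun U f => exists i, U = setT /\
    f = (fun x : 'rV[k]_n => x ord0 i)) setT (fun x : 'rV[k]_n => x ord0 i)
    (gen_section_gen (ex_intro _ i (conj erefl erefl))).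
move=> /set_type_val[a <-] Wa.
have [oW' rW'] := @gen_space_section k (set_type U) (fun W f =>
    exists (V : set X) (g : X -> k),
    [/\ open V, regular V g, W = (fun a : set_type U => V (val a)) &
    f = (fun a => g (val a))]) (fun a => W (val a)) (fun a => h (val a))
    (gen_section_gen (ex_intro _ W (ex_intro _ h (And4 oW rW erefl erefl)))).
have [_ rpsi] := mor_morphism psi.
have rZ := rpsi _ _ oW' rW'.
have Wpa : (psi @^-1` (fun b : set_type U => W (val b))) (phi a).
  by rewrite /preimage /= phiK.
have [|P [Q [pP pQ Qa HQ]]] :=
  gen_regular_quotient (xi := co) (D := setT) _ rZ I Wpa.
  move=> _ _ b [V [g [oV rV -> ->]]] _ Vb.
    have [|P [Q [[N pP] [M pQ] Qb HQ]]] := gen_regular_quotient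
      (xi := fun i (x : 'rV[k]_n) => x ord0 i) (D := setT) _ rV (z := val b) I Vb.
      move=> _ f x [i [-> ->]] _ _.
      exists (fun x : 'rV[k]_n => x ord0 i), (fun=> 1); split.
      + by exists 1%N; exact: (pol_coord (fun i (x : 'rV[k]_n) => x ord0 i)).
      + by exists 1%N; exact: pol_cst.
      + exact: oner_neq0.
      + by move=> y _ _; rewrite mulr1.
    exists (fun b => P (val b)), (fun b => Q (val b)); split.
    + by move: pP => [c Hc]; exists N, c => y; exact: Hc.
    + by move: pQ => [c Hc]; exists M, c => y; exact: Hc.
    + exact: Qb.
    + by move=> y _ Qy; exact: HQ.
exists (P \o rho), (Q \o rho); split.
- by move: pP => [N [c Hc]]; exists N, c => y; exact: Hc.
- by move: pQ => [N [c Hc]]; exists N, c => y; exact: Hc.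
- by rewrite /= rhoE.
- move=> _ /set_type_val[b <-]; rewrite /= rhoE => /(HQ _ I).
  by rewrite /preimage /= phiK.
Qed.

End AffineChart.

Lemma chart_widen (X : funSpace k) (U : set X) n m (xi : 'I_n -> X -> k) :
  chart U xi -> (n <= m)%N ->
  exists xi' : 'I_m -> X -> k, chart U xi'.
Proof.
move=> [oU rxi loc] nm.
pose xi' (i : 'I_m) : X -> k := oapp xi (fun=> 0) (insub (val i)).
exists xi'; split=> // [i|W h z oW rW Uz Wz].
  by rewrite /xi'; case: insub => [j|] /=; [exact: rxi|exact: regular_cst].
have [P [Q [[N pP] [M pQ] Qz HQ]]] := loc W h z oW rW Uz Wz.
have subst N' f : pol xi N' f -> exists e, pol xi' e f.
  apply: (pol_subst (rho := id)) => i; exists 1%N.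
  have := pol_coord xi' (widen_ord nm i) (ltnSn 0); apply: eq_pol => x.
  by rewrite /xi' insubT//= => lt; congr (xi _ x); exact: val_inj.
by exists P, Q; split=> //; [exact: subst pP|exact: subst pQ].
Qed.

End Charts.

(** * The basis theorem and irreducible components *)

Section Noetherian.
Implicit Types R : comNzRingType.

Definition combination R (n : nat) (a : nat -> R) (x : R) : Prop :=
  exists c : nat -> R, x = \sum_(i < n) c i * a i.

Definition noetherian R : Prop :=
  forall a : nat -> R, exists m, combination m a (a m).

Lemma combinationD R n (a : nat -> R) x y :
  combination n a x -> combination n a y -> combination n a (x + y).
Proof.
move=> [c ->] [d ->]; exists (fun i => c i + d i).
by rewrite -big_split; apply: eq_bigr => i _; rewrite mulrDl.
Qed.

Lemma combinationM R n (a : nat -> R) x y :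
  combination n a y -> combination n a (x * y).
Proof.
move=> [c ->]; exists (fun i => x * c i).
by rewrite mulr_sumr; apply: eq_bigr => i _; rewrite mulrA.
Qed.

Lemma combination_sum R n (a : nat -> R) (L : Type) (r : seq L) (P : pred L)
    (F : L -> R) : (forall l, P l -> combination n a (F l)) ->
  combination n a (\sum_(l <- r | P l) F l).
Proof.
move=> HF; elim/big_rec: _ => [|l x Pl]; last by apply: combinationD; exact: HF.
by exists (fun=> 0); rewrite big1// => i _; rewrite mul0r.
Qed.

Lemma combination_gen R n (a : nat -> R) i : (i < n)%N -> combination n a (a i).
Proof.
move=> lt; exists (fun j => (j == i)%:R); rewrite (bigD1 (Ordinal lt))//= eqxx.
rewrite mul1r big1 ?addr0// => j; rewrite -val_eqE => /= /negPf->.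
by rewrite mul0r.
Qed.

Lemma combination_trans R n m (a b : nat -> R) x :
  (forall i, (i < n)%N -> combination m b (a i)) -> combination n a x ->
  combination m b x.
Proof.
move=> ab [c ->]; apply: combination_sum => i _; apply: combinationM.
exact: ab.
Qed.

Lemma combination_le R n m (a : nat -> R) x :
  (n <= m)%N -> combination n a x -> combination m a x.
Proof.
move=> nm; apply: combination_trans => i lt; apply: combination_gen.
exact: leq_trans nm.
Qed.

Lemma noetherian_field (F : fieldType) : noetherian F.
Proof.
move=> a; have [a0|a0] := eqVneq (a 0%N) 0.
  by exists 0%N, (fun=> 0); rewrite big_ord0.
by exists 1%N, (fun=> a 1%N / a 0%N); rewrite big_ord1 divfK.
Qed.

(** In an ideal that is generated by a sequence and has no finite basis, choose
    b_m of least degree outside the ideal generated by b_0, ..., b_(m-1).  When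
    the leading coefficient of some b_m is a combination of the previous ones,
    subtracting the same combination of shifts of the b_i lowers the degree of
    b_m, which contradicts its choice. *)
Lemma noetherian_poly R : noetherian R -> noetherian {poly R}.
Proof.
move=> noethR a; apply: contrapT => /forallNP an.
pose I p := exists n, combination n a p.
have ID p q : I p -> I q -> I (p + q).
  move=> [n cp] [m cq]; exists (n + m)%N; apply: combinationD.
    exact: combination_le (leq_addr _ _) cp.
  exact: combination_le (leq_addl _ _) cq.
have IM p q : I q -> I (p * q).
  by move=> [n cq]; exists n; exact: combinationM.
have Isum m (F : 'I_m -> {poly R}) : (forall i, I (F i)) -> I (\sum_i F i).
  move=> IF; elim/big_rec: _ => [|i p _ Ip]; last exact: ID.
  by exists 0%N, (fun=> 0); rewrite big_ord0.
have outside (s : seq {poly R}) : (forall i, (i < size s)%N -> I s`_i) ->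
    exists2 p, I p & ~ combination (size s) (fun i => s`_i) p.
  move=> sI; apply: contrapT => sbasis.
  have /choice[N HN] i : exists N, (i < size s)%N -> combination N a s`_i.
    case: ltnP => [/sI[N cN]|]; first by exists N.
    by exists 0%N.
  pose m := (\max_(i < size s) N i)%N; apply: (an m).
  apply: (@combination_trans _ (size s) m (fun i => s`_i) a).
    move=> i lt; apply: (combination_le _ (HN i lt)).
    exact: (leq_bigmax (Ordinal lt)).
  apply: contrapT => nam; apply: sbasis; exists (a m) => //.
  by exists m.+1; exact: combination_gen.
have least (s : seq {poly R}) : exists p, (forall i, (i < size s)%N -> I s`_i) ->
    [/\ I p, ~ combination (size s) (fun i => s`_i) p & forall q, I q ->
      ~ combination (size s) (fun i => s`_i) q -> (size p <= size q)%N].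
  have [sI|nsI] := pselect (forall i, (i < size s)%N -> I s`_i); last by exists 0.
  pose P d := `[< exists p, [/\ I p, ~ combination (size s) (fun i => s`_i) p
     & size p = d] >].
  have exP : exists d, P d.
    by have [p Ip np] := outside s sI; exists (size p); apply/asboolP; exists p.
  case: (ex_minnP exP) => d /asboolP[p [Ip np <-]] pmin.
  exists p => _; split=> // q Iq nq; apply: pmin; apply/asboolP.
  by exists q.
have [next Hnext] := choice least.
pose bs := fix bs m := if m is m'.+1 then rcons (bs m') (next (bs m')) else [::].
pose b m := next (bs m).
have size_bs m : size (bs m) = m by elim: m => //= m IHm; rewrite size_rcons IHm.
have nth_bs m i : (i < m)%N -> (bs m)`_i = b i.
  elim: m => //= m IHm; rewrite ltnS leq_eqVlt nth_rcons size_bs.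
  by case: eqP => [->|_ /= lt]; rewrite ?ltnn// lt IHm.
have comb_bs m p : combination m (fun i => (bs m)`_i) p <-> combination m b p.
  split=> [[c ->]|[c ->]]; exists c; apply: eq_bigr => i _; rewrite nth_bs//.
have Hb m : [/\ I (b m), ~ combination m b (b m) & forall q, I q ->
    ~ combination m b q -> (size (b m) <= size q)%N].
  elim/ltn_ind: m => m IHm; have [|Ib nb minb] := Hnext (bs m).
    by move=> i; rewrite size_bs => lt; rewrite nth_bs//; case: (IHm i lt).
  rewrite size_bs in nb minb; split=> // [/comb_bs//|q Iq nq].
  by apply: minb => // /comb_bs.
have [m [c lcm]] := noethR (fun m => lead_coef (b m)).
have [Ibm nbm _] := Hb m.
have size_b i : (i < m)%N -> (size (b i) <= size (b m))%N.
  move=> im; have [_ _] := Hb i; apply => // cm.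
  by apply: nbm; exact: combination_le (ltnW im) cm.
pose r := \sum_(i < m) (c i *: 'X^(size (b m) - size (b i))) * b i.
have cr : combination m b r by exists (fun i => c i *: 'X^(size (b m) - size (b i))).
have nq : ~ combination m b (b m - r).
  by move=> /combinationD/(_ cr); rewrite subrK.
have [_ _ /(_ (b m - r)) min] := Hb m.
have b0 : b m != 0.
  apply/eqP => b0; apply: nbm; rewrite b0.
  by exists (fun=> 0); rewrite big1// => i _; rewrite mul0r.
have : (size (b m) <= size (b m - r)%R)%N.
  apply: min => //; apply: ID => //; rewrite -mulN1r; apply: (IM).
  by apply: Isum => i; apply: IM; case: (Hb i).
have b_gt0 : (0 < size (b m))%N by rewrite size_poly_gt0.
have coef_r : r`_(size (b m)).-1 = lead_coef (b m).
  rewrite lcm /r coef_sum; apply: eq_bigr => i _.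
  rewrite -scalerAl coefZ coefXnM lead_coefE.
  have [bi0|bi0] := posnP (size (b i)).
    have -> : b i = 0 by apply/eqP; rewrite -size_poly_eq0 bi0.
    by rewrite !coef0 if_same.
  have le := size_b i (ltn_ord i); case: ltnP => [|_]; first by lia.
  by congr (_ * _`_ _); lia.
rewrite leqNgt => /negP; apply; rewrite -[ltnRHS](prednK b_gt0) ltnS.
apply/leq_sizeP => j; rewrite leq_eqVlt => /predU1P[<-|lt].
  by rewrite coefB coef_r lead_coefE subrr.
have {}lt : (size (b m) <= j)%N by rewrite -(prednK b_gt0).
rewrite coefB nth_default//.
rewrite /r coef_sum big1 ?subr0// => i _; rewrite -scalerAl coefZ coefXnM.
have le := size_b i (ltn_ord i).
case: ifP => _; rewrite ?mulr0// nth_default ?mulr0//.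
by apply: leq_trans (leq_sub2r _ lt); rewrite subKn.
Qed.

Variable k : fieldType.

Fixpoint mpolys (n : nat) : comNzRingType :=
  if n is n'.+1 then {poly mpolys n'} else k.

Fixpoint meval (n : nat) (x : nat -> k) : {rmorphism mpolys n -> k} :=
  match n with
  | 0 => idfun
  | n'.+1 => (horner_eval (x n') \o map_poly (meval n' x) :
               {rmorphism {poly mpolys n'} -> k})
  end.

Lemma noetherian_mpolys n : noetherian (mpolys n).
Proof.
by elim: n => [|n IHn]; [exact: noetherian_field|exact: noetherian_poly].
Qed.

Lemma mevalC n c : exists p : mpolys n, forall x, meval n x p = c.
Proof.
elim: n => [|n [p Hp]]; first by exists c.
by exists p%:P => x; rewrite /= map_polyC /horner_eval hornerC /= Hp.
Qed.

Lemma mevalX n i : (i < n)%N -> exists p : mpolys n, forall x, meval n x p = x i.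
Proof.
elim: n => // n IHn; rewrite ltnS leq_eqVlt => /predU1P[->|/IHn[p Hp]].
  by exists 'X => x; rewrite /= map_polyX /horner_eval hornerX.
by exists p%:P => x; rewrite /= map_polyC /horner_eval hornerC /= Hp.
Qed.

Lemma pol_meval n T (xi : 'I_n -> T -> k) N f : pol xi N f ->
  exists p : mpolys n, forall z,
    f z = meval n (fun j => oapp (xi^~ z) 0 (insub j)) p.
Proof.
move=> [c Hc].
have /choice[C HC] (a : {ffun 'I_n -> 'I_N.+1}) := mevalC n (c a).
have /choice[Y HY] (i : 'I_n) := mevalX (ltn_ord i).
exists (\sum_a C a * \prod_i Y i ^+ a i) => z.
rewrite Hc rmorph_sum; apply: eq_bigr => a _; rewrite rmorphM HC; congr *%R.
rewrite rmorph_prod; apply: eq_bigr => i _.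
by rewrite rmorphXn HY valK.
Qed.

Lemma pol_noetherian n T (xi : 'I_n -> T -> k) (f : nat -> T -> k) :
  (forall i, exists N, pol xi N (f i)) ->
  exists m, forall z, (forall i, (i < m)%N -> f i z = 0) -> f m z = 0.
Proof.
move=> pf; have /choice[p Hp] i : exists p : mpolys n, forall z,
    f i z = meval n (fun j => oapp (xi^~ z) 0 (insub j)) p.
  by have [N] := pf i; exact: pol_meval.
have [m [c pm]] := noetherian_mpolys p; exists m => z f0.
rewrite Hp pm rmorph_sum big1// => i _.
by rewrite rmorphM -Hp f0 ?mulr0.
Qed.

Section Decomposition.
Variable X : funSpace k.

Definition irreducible_union (A : set X) : Prop :=
  exists (C : finType) (Z : C -> set X), (forall c, irreducible_set (Z c)) /\
    A = \bigcup_c Z c.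

Lemma irreducible_union_bigcup (J : finType) (A : J -> set X) :
  (forall j, irreducible_union (A j)) -> irreducible_union (\bigcup_j A j).
Proof.
move=> irA; pose C j := projT1 (cid (irA j)).
pose Z j : C j -> set X := projT1 (cid (projT2 (cid (irA j)))).
have HZ j : (forall c, irreducible_set (Z j c)) /\ A j = \bigcup_c Z j c.
  exact: projT2 (cid (projT2 (cid (irA j)))).
exists {j : J & C j}, (fun jc => Z (tag jc) (tagged jc)); split.
  by move=> [j c]; case: (HZ j).
apply/seteqP; split=> [x [j _]|x [[j c] _] Zx].
  by have [_ ->] := HZ j => -[c _ Zx]; exists (Tagged C c).
by exists j => //; have [_ ->] := HZ j; exists c.
Qed.

Lemma irreducible_unionU (A B : set X) :
  irreducible_union A -> irreducible_union B -> irreducible_union (A `|` B).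
Proof.
move=> irA irB; rewrite (_ : A `|` B = \bigcup_(b in [set: bool]) if b then A else B).
  by apply: (@irreducible_union_bigcup bool) => -[].
apply/seteqP; split=> [x [Ax|Bx]|x [[] _]]; [|by exists false|by left|by right].
by exists true.
Qed.

(** Noetherian induction: if the trace on U of a closed set is not a finite
    union of irreducible sets, the same holds for a smaller closed set, and so
    on.  Polynomials that vanish on each closed set of the sequence, but not on
    the previous one, contradict the basis theorem. *)
Lemma chart_irreducible_union (U : set X) n (xi : 'I_n -> X -> k) :
  chart U xi -> irreducible_union U.
Proof.
move=> cU; apply: contrapT => badU.
pose bad Z := closed Z /\ ~ irreducible_union (U `&` Z).
have /choice[next Hnext] (Z : set X) : exists Z', bad Z ->
    [/\ bad Z', Z' `<=` Z & exists x, [/\ U x, Z x & ~ Z' x]].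
  have [[cZ badZ]|] := pselect (bad Z); last by exists set0.
  have [[x0 UZx0]|/set0P/negP/negPn/eqP UZ0] := pselect (U `&` Z !=set0); last first.
    exfalso; apply: badZ; exists 'I_0, (fun=> set0); split; first by case.
    by rewrite UZ0; apply/seteqP; split=> // x [[]].
  have : ~ irreducible_set (U `&` Z).
    move=> irUZ; apply: badZ; exists unit, (fun=> U `&` Z); split=> //.
    by apply/seteqP; split=> [x UZx|x []//]; exists tt.
  move=> /not_andP[|/existsNP[O1]]; first by case; exists x0.
  move=> /existsNP[O2 /not_implyP[oO1 /not_implyP[oO2]]].
  move=> /not_implyP[[x1 [[Ux1 Zx1] Ox1]] /not_implyP[[x2 [[Ux2 Zx2] Ox2]] O12]].
  have UZE : U `&` Z = (U `&` (Z `&` ~` O1)) `|` (U `&` (Z `&` ~` O2)).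
    apply/seteqP; split=> x; last by move=> [[? []]|[? []]].
    move=> [Ux Zx]; have [O1x|] := pselect (O1 x); last by left.
    have [O2x|] := pselect (O2 x); last by right.
    by exfalso; apply: O12; exists x.
  have [ir1|bad1] := pselect (irreducible_union (U `&` (Z `&` ~` O1))).
    have [ir2|bad2] := pselect (irreducible_union (U `&` (Z `&` ~` O2))).
      by exfalso; apply: badZ; rewrite UZE; exact: irreducible_unionU.
    exists (Z `&` ~` O2) => _; split; last by exists x2; split=> // -[].
      by split=> //; apply: closedI => //; exact: open_closedC.
    by move=> x [].
  exists (Z `&` ~` O1) => _; split; last by exists x1; split=> // -[].
    by split=> //; apply: closedI => //; exact: open_closedC.
  by move=> x [].
pose Z m := iter m next setT.
have badZ m : bad (Z m).
  elim: m => [|m /Hnext[]//]; split; first exact: closedT.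
  by rewrite setIT.
have /choice[x Hx] m : exists x, [/\ U x, Z m x & ~ Z m.+1 x].
  by have [] := Hnext _ (badZ m).
have Zsub m i : (i <= m)%N -> Z m `<=` Z i.
  elim: m => [|m IHm]; first by rewrite leqn0 => /eqP->.
  rewrite leq_eqVlt => /predU1P[->//|]; rewrite ltnS => /IHm.
  by apply: subset_trans; case: (Hnext _ (badZ m)).
have /choice[f Hf] m : exists f, [/\ exists N, pol xi N f, f (x m) != 0 &
    forall y, U y -> Z m.+1 y -> f y = 0].
  have [Ux _ nZx] := Hx m; have [cZ _] := badZ m.+1.
  by have [N [f [pf fx f0]]] := chart_closed cU cZ Ux nZx; exists f; split=> //; exists N.
have [|m fm] := @pol_noetherian _ _ xi f; first by move=> m; case: (Hf m).
have [_ /eqP fx _] := Hf m; apply: fx; apply: fm => i im.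
have [_ _ f0] := Hf i; have [Ux Zx _] := Hx m; apply: f0 => //.
exact: Zsub Zx.
Qed.

(** The closures of the members of a finite irreducible cover of X still cover
    X; in a minimal subcover none of them contains another one. *)
Lemma irreducible_components : irreducible_union setT ->
  exists (C : finType) (Z : C -> set X), [/\ forall c, irreducible_set (Z c),
    forall c, closed (Z c), forall x, exists c, Z c x &
    forall c c', Z c `<=` Z c' -> c = c'].
Proof.
move=> [C [Z [irZ ZT]]]; pose P (S : {set C}) :=
  `[< forall x, exists2 c, c \in S & closure (Z c) x >].
have PT : P finset.setT.
  apply/asboolP => x; have : [set: X] x by [].
  by rewrite ZT => -[c _ Zx]; exists c; [rewrite inE|exact: subset_closure].
have [S /minsetP[/asboolP coverS minS] _] := minset_exists PT.
exists {c | c \in S}, (fun c => closure (Z (val c))); split.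
- by move=> c; apply: irreducible_closure.
- by move=> c; exact: closed_closure.
- by move=> x; have [c cS Zx] := coverS x; exists (exist _ c cS).
move=> c c' cc'; apply/eqP; rewrite -val_eqE; apply/negP => /negP neq.
have /minS : P (S :\ val c)%SET.
  apply/asboolP => x; have [d dS Zx] := coverS x.
  have [dc|dc] := eqVneq d (val c); last by exists d => //; rewrite !inE dc.
  exists (val c'); last by apply: cc'; rewrite -dc.
  by rewrite !inE eq_sym neq (valP c').
by rewrite subD1set => /(_ isT)/setP/(_ (val c)); rewrite !inE eqxx (valP c).
Qed.

End Decomposition.
End Noetherian.

(** * Comparison of growths along a retraction *)

Lemma irreducible_set1 (T : topologicalType) (x : T) : irreducible_set [set x].
Proof.
split; first by exists x.
by move=> O1 O2 _ _ [_ [-> O1x]] [_ [-> O2x]]; exists x.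
Qed.

Lemma finite_bound (L : finType) (P : L -> nat -> Prop) :
  (forall l m n, (m <= n)%N -> P l m -> P l n) ->
  (forall l, exists n, P l n) -> exists n, forall l, P l n.
Proof.
move=> mon /choice[N HN]; exists (\max_l N l)%N => l.
by apply: mon (HN l); exact: leq_bigmax.
Qed.

Section Geometry.
Variables (k : fieldType) (X : funSpace k).
Variables (C : finType) (Z : C -> set X).
Hypothesis irrZ : forall c, irreducible_set (Z c).
Hypothesis closedZ : forall c, closed (Z c).
Hypothesis coverZ : forall x, exists c, Z c x.
Hypothesis antichainZ : forall c c', Z c `<=` Z c' -> c = c'.
Variables (J I : finType) (U : J -> set X) (xi : J -> I -> X -> k).
Hypothesis chartU : forall j, chart (U j) (xi j).
Hypothesis coverU : forall x, exists j, U j x.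

(** The maximum over all charts makes it harmless that the generic point of an
    image may land in any of them. *)
Definition growth (c : C) (N : nat) : nat :=
  (\max_j mrank (xi j) (Z c `&` U j) N)%N.

Lemma growth_gt0 c N : (0 < growth c N)%N.
Proof.
have [[x Zx] _] := irrZ c; have [j Ux] := coverU x.
have : (0 < mrank (xi j) (Z c `&` U j) N)%N by exact: (@mrank_gt0 _ _ _ _ _ _ x).
by move=> /leq_trans; apply; exact: (leq_bigmax j).
Qed.

Lemma growth_le c N : (growth c N <= N.+1 ^ #|I|)%N.
Proof. by apply/bigmax_leqP => j _; exact: mrank_le. Qed.

Lemma growth_mono c N N' : (N <= N')%N -> (growth c N <= growth c N')%N.
Proof.
move=> NN'; apply/bigmax_leqP => j _.
by apply: leq_trans (mrank_mono _ _ NN') _; exact: (leq_bigmax j).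
Qed.

Variable V : finType.
Notation XV := (fibre_power V X).

Definition chart_piece (c : V -> C) (j : V -> J) : set XV :=
  [set y | forall v, (Z (c v) `&` U (j v)) ((y : V -> X) v)].

Lemma open_U j : open (U j).
Proof. by have [] := chartU j. Qed.

Lemma chart_power (j : V -> J) :
  chart ([set y | forall v, U (j v) ((y : V -> X) v)] : set XV)
    (prod_coord (fun v => xi (j v))).
Proof.
exact: (chart_box (U := fun v => U (j v)) (fun v => chartU (j v))).
Qed.

Lemma irreducible_chart_piece c j y0 : chart_piece c j y0 ->
  irreducible_set (chart_piece c j).
Proof.
move=> y0P; apply: (irreducible_box (Z := fun v => Z (c v) `&` U (j v))) => v.
apply: irreducible_setI_open => //; first exact: open_U.
by exists ((y0 : V -> X) v); exact: y0P.
Qed.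

Variables (W : finType) (Nb : W -> {set V}) (Theta : W -> set XV).
Hypothesis disjNb : forall w w' v, v \in Nb w -> v \in Nb w' -> w = w'.
Hypothesis closedTheta : forall w, closed (Theta w).
Hypothesis localTheta : forall w (y y' : V -> X),
  (forall v, v \in Nb w -> y v = y' v) -> Theta w y -> Theta w y'.

(** Each condition Theta w is proper on its own block of coordinates, and the
    other coordinates are free; so every one of them costs a linear factor. *)
Lemma mrank_conditions (c : V -> C) (j : V -> J) (y0 : XV) (r : seq W) :
  uniq r -> chart_piece c j y0 ->
  (forall w, w \in r -> exists y : V -> X,
     (forall v, Z (c v) (y v)) /\ ~ Theta w y) ->
  exists E, forall N,
    (N.+1 ^ size r * mrank (prod_coord (fun v => xi (j v)))
       (chart_piece c j `&` [set y | forall w, w \in r -> Theta w y]) N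
     <= mrank (prod_coord (fun v => xi (j v))) (chart_piece c j) (E * N))%N.
Proof.
move=> + y0P; elim: r => [_ _|w r IHr /= /andP[wr ur] properT].
  exists 1%N => N; rewrite expn0 !mul1n; apply: rank_subset.
  by move=> y [].
have [w' w'r|E HE] := IHr ur; first by apply: properT; rewrite inE w'r orbT.
have [y [Zy nTy]] := properT w (mem_head _ _).
have cU := chart_power j; have [oUj _ _] := cU.
have [y1 [Zy1 [Uy1 nTy1]]] : [set y : XV | forall v, Z (c v) ((y : V -> X) v)]
    `&` ([set y | forall v, U (j v) ((y : V -> X) v)] `&` ~` Theta w) !=set0.
  have [_ irr] := irreducible_box (V := V) (fun v => irrZ (c v)).
  apply: irr => //; first exact: closed_openC.
  - by exists y0; split=> v; case: (y0P v).
  - by exists y.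
have [e [f [pf fy1 f0]]] := chart_closed cU (@closedTheta w) Uy1 nTy1.
(* The equation f of Theta w, made to depend on the coordinates of the block
   of w only. *)
pose rho (y : V -> X) v := if v \in Nb w then y v else (y1 : V -> X) v.
have [e' pphi] : exists e', pol (prod_coord (fun v => xi (j v))) e' (f \o rho).
  apply: pol_subst pf => -[v i]; exists 1%N; have [vw|vw] := boolP (v \in Nb w).
    have := pol_coord (prod_coord (fun v => xi (j v))) (v, i) (ltnSn 0).
    by apply: eq_pol => z; rewrite /prod_coord /= /rho vw.
  have := pol_cst (prod_coord (fun v => xi (j v))) 1 (xi (j v) i ((y1 : V -> X) v)).
  by apply: eq_pol => z; rewrite /prod_coord /= /rho (negPf vw).
pose D := chart_piece c j `&` [set y | forall w, w \in r -> Theta w y].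
pose D' := chart_piece c j `&` [set y | forall w', w' \in w :: r -> Theta w' y].
have D'D : D' `<=` D.
  by move=> z [Pz Tz]; split=> // w' w'r; apply: Tz; rewrite inE w'r orbT.
have phi0 z : D' z -> (f \o rho) z = 0.
  move=> [Pz Tz]; apply: f0 => [v|] /=.
    by rewrite /rho; case: ifP => _; [case: (Pz v)|exact: Uy1].
  apply: (@localTheta w z); last by apply: Tz; exact: mem_head.
  by move=> v vw; rewrite /rho vw.
exists (E * e'.+1)%N => N.
have reg M g : pol (prod_coord (fun v => xi (j v))) M g ->
    (forall z, D z -> (f \o rho) z * g z = 0) -> forall z, D z -> g z = 0.
  move=> pg fg0 z [Pz Tz].
  pose A : set XV := [set y | forall v, (if v \in Nb w then
    Z (c v) `&` U (j v) else [set (z : V -> X) v]) ((y : V -> X) v)].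
  have irA : irreducible_set A.
    apply: (irreducible_box (Z := fun v => if v \in Nb w then
      Z (c v) `&` U (j v) else [set (z : V -> X) v])) => v.
    case: ifP => _; last exact: irreducible_set1.
    apply: irreducible_setI_open => //; first exact: open_U.
    by exists ((z : V -> X) v); exact: Pz.
  have AD : A `<=` D.
    move=> y' Ay'; split=> [v|w' w'r].
      by have := Ay' v; case: ifP => // _ ->; exact: Pz.
    apply: (@localTheta w' z); last exact: Tz.
    move=> v vw'; have := Ay' v; case: ifP => [vw|_ ->//].
    by move: wr; rewrite (disjNb vw vw') w'r.
  have AU : A `<=` [set y | forall v, U (j v) ((y : V -> X) v)].
    by move=> y' /AD[Py' _] v; case: (Py' v).
  pose z1 v := if v \in Nb w then (y1 : V -> X) v else (z : V -> X) v.
  have Az1 : A z1.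
    by move=> v; rewrite /z1; case: ifP.
  have fz1 : (f \o rho) z1 != 0.
    rewrite /= (_ : rho z1 = y1)//; apply/funext => v; rewrite /rho /z1.
    by case: (v \in Nb w).
  apply: (chart_nonzerodivisor cU irA AU pphi pg Az1 fz1).
    by move=> y' /AD; exact: fg0.
  by move=> v; case: ifP => // _; exact: Pz.
rewrite expnSr -mulnA.
apply: leq_trans (leq_mul (leqnn _) (mrank_hypersurface N D'D phi0 pphi reg)) _.
have := HE (e' * N + N)%N; rewrite -mulSnr mulnA; apply: leq_trans.
rewrite leq_mul//; case: (size r) => // m.
by rewrite leq_exp2r// ltnS leq_pmull.
Qed.

Section Retraction.
Variables (f g : (V -> X) -> V -> X) (Gd : {set V}).
Hypothesis morph_f : is_morphism (f : XV -> XV).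
Hypothesis morph_g : is_morphism (g : XV -> XV).
Hypothesis retractE : forall x v, v \in Gd -> g (f x) v = x v.

Lemma box_component (h : (V -> X) -> V -> X) (c : V -> C) :
  is_morphism (h : XV -> XV) ->
  exists c' : V -> C, forall x : V -> X, (forall v, Z (c v) (x v)) ->
    forall v, Z (c' v) (h x v).
Proof.
move=> morph_h; have irr := irreducible_box (V := V) (fun v => irrZ (c v)).
have /choice[c' Hc'] v : exists c', (fun x : XV => h x v) @`
    [set y : XV | forall v, Z (c v) ((y : V -> X) v)] `<=` Z c'.
  apply: irreducible_sub_closed => //.
  by apply: irreducible_image irr; have [] := is_morphism_comp (is_morphism_proj X v) morph_h.
by exists c' => x Zx v; apply: Hc'; exists x.
Qed.

Section Source.
Variables (c : V -> C) (i : V -> J) (c' : V -> C).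
Hypothesis c'E : forall x : V -> X, (forall v, Z (c v) (x v)) ->
  forall v, Z (c' v) (f x v).
Hypothesis f_Theta : forall w x, Theta w (f x).
Hypothesis meet_ci : forall v, Z (c v) `&` U (i v) !=set0.

(** The coordinates of x are g (f x), hence near a point of the image they are
    quotients of polynomials in the coordinates of f x; clearing denominators,
    polynomials of degree N in x become polynomials of degree O(N) in f x. *)
Lemma mrank_retraction : exists (j : V -> J) (y0 : XV) (E : nat),
  chart_piece c' j y0 /\ forall N,
  (\prod_(v in Gd) mrank (xi (i v)) (Z (c v) `&` U (i v)) N
   <= mrank (prod_coord (fun v => xi (j v)))
        (chart_piece c' j `&` [set y | forall w, Theta w y]) (E.+1 * N))%N.
Proof.
have /choice[x0 Hx0] := meet_ci.
pose y0 := f x0; have /choice[j Uy0] v : exists j, U j (y0 v) by exact: coverU.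
have cUj := chart_power j; have cUi := chart_power i; have [oUj _ locj] := cUj.
set xj := prod_coord _ in cUj locj *.
pose Uj : set XV := [set y | forall v, U (j v) ((y : V -> X) v)].
have Py0 : chart_piece c' j y0.
  by move=> v; split; [apply: c'E => v'; case: (Hx0 v')|exact: Uy0].
have /choice[PQ HPQ] (vl : V * I) : exists PQ : (XV -> k) * (XV -> k), vl.1 \in Gd ->
    [/\ exists N, pol xj N PQ.1, exists N, pol xj N PQ.2, PQ.2 y0 != 0 &
    forall y : V -> X, Uj y -> PQ.2 y != 0 ->
      xi (i vl.1) vl.2 (g y vl.1) * PQ.2 y = PQ.1 y].
  case: vl => v l /=; case: (boolP (v \in Gd)) => vG; last by exists (fun=> 0, fun=> 0).
  have [cg rg] := is_morphism_comp (is_morphism_proj X v) morph_g.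
  have [oUi rxi _] := chartU (i v).
  have oW : open [set y : XV | U (i v) (g y v)] by move/continuousP: cg => /(_ _ oUi).
  have [|P [Q [pP pQ Qy HQ]]] := locj _ _ y0 oW (rg _ _ oUi (rxi l)) Uy0.
    by rewrite /= /y0 retractE//; case: (Hx0 v).
  exists (P, Q) => _; split=> // y Uy Qy0.
  by case: (HQ y Uy Qy0).
have [N0 HN0] : exists N0, forall vl : V * I, vl.1 \in Gd ->
    pol xj N0 (PQ vl).1 /\ pol xj N0 (PQ vl).2.
  apply: finite_bound => [vl m n mn H /H[p1 p2]|vl].
    by split; exact: pol_le mn _.
  case: (boolP (vl.1 \in Gd)) => [/HPQ[[N1 p1] [N2 p2] _ _]|]; last by exists 0%N.
  exists (N1 + N2)%N => _.
  by split; [exact: pol_le (leq_addr _ _) p1|exact: pol_le (leq_addl _ _) p2].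
pose Q (y : XV) := \prod_(vl : V * I | vl.1 \in Gd) (PQ vl).2 y.
have pQ : pol xj (#|{: V * I}| * N0)%N Q.
  by apply: pol_prod => vl /HN0[].
pose O : set XV := f @^-1` (Uj `&` [set y | Q y != 0]).
have oO : open O.
  by have [/continuousP + _] := morph_f; apply; exact: (chart_open cUj pQ).
pose A := chart_piece c i.
have Ax0 : A x0 by move=> v; exact: Hx0.
have irA : irreducible_set A := irreducible_chart_piece Ax0.
have Ox0 : O x0.
  split=> [//|]; rewrite /= /Q prodf_seq_neq0; apply/allP => vl _.
  by apply/implyP => /HPQ[].
exists j, y0, (#|{: V * I}| * N0)%N; split=> // N.
pose F (v : V) (a : {ffun I -> 'I_N.+1}) (x : X) : k :=
  if v \in Gd then mono (xi (i v)) a x else 1.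
apply: (@leq_trans (\prod_v rank_on (Z (c v) `&` U (i v)) (F v))%N).
  rewrite big_mkcond; apply: leq_prod => v _; rewrite /F; case: ifP => // _.
  by apply: (@rank_gt0 _ _ _ _ _ [ffun=> ord0]) (Hx0 v) (oner_neq0 _).
apply: leq_trans (rank_prod_ge _ Hx0) _.
have [S [frS <- _]] := rank_basis [set y | forall v, (Z (c v) `&` U (i v)) (y v)]
  (prod_family F).
pose u (x : XV) : k := \prod_(vl : V * I | vl.1 \in Gd) (PQ vl).2 (f x) ^+ N.
have QO x (vl : V * I) : O x -> vl.1 \in Gd -> (PQ vl).2 (f x) != 0.
  by move=> [_ /=]; rewrite /Q => /prodf_neq0; apply.
apply: (free_card_le (O := A `&` O) (psi := f) (u := u) frS).
- move=> x [Ax Ox]; have Zx v : Z (c v) ((x : V -> X) v) by case: (Ax v).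
  split; last by apply/prodf_neq0 => vl vG; rewrite expf_neq0// QO.
  split; last by move=> w; exact: f_Theta.
  by move=> v; split; [exact: c'E|case: Ox => + _; apply].
- move=> d d0; apply: (chart_dense (O := O) cUi irA).
  + by move=> x Ax v; case: (Ax v).
  + apply: (pol_sum (N := (#|V| * (#|I| * (1 * N))))%N) => b _; apply: polZ.
    apply: pol_prod => v _; rewrite /F; case: (v \in Gd); last exact: pol_cst.
    apply: pol_prod => l _.
    have := pol_exp (b v l)
      (pol_coord (prod_coord (fun v => xi (i v))) (v, l) (ltnSn 0)).
    by apply: pol_le; rewrite leq_mul// -ltnS.
  + exact: oO.
  + by exists x0.
  + by move=> x Ax Ox; apply: d0.
- move=> b _.
  pose G (y : XV) := \prod_(vl : V * I | vl.1 \in Gd)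
    ((PQ vl).1 y ^+ b vl.1 vl.2 * (PQ vl).2 y ^+ (N - b vl.1 vl.2)).
  have pG : pol xj (#|{: V * I}| * (N0 * N)) G.
    apply: pol_prod => vl /HN0[pP pQ'].
    have le : (b vl.1 vl.2 <= N)%N by rewrite -ltnS.
    have := polM (pol_exp (b vl.1 vl.2) pP) (pol_exp (N - b vl.1 vl.2) pQ').
    by rewrite -mulnDr subnKC.
  have [|d Hd] := pol_le (N' := ((#|{: V * I}| * N0).+1 * N)%N) _ pG.
    by rewrite mulnA leq_mul.
  exists d => x [Ax Ox]; rewrite -Hd /u /G /prod_family /F.
  rewrite -big_mkcond /= [X in _ * X](_ : _ = \prod_(vl : V * I | vl.1 \in Gd)
      xi (i vl.1) vl.2 (x vl.1) ^+ b vl.1 vl.2); last first.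
    by rewrite /mono pair_big_dep; apply: eq_bigl => vl; rewrite andbT.
  rewrite -big_split; apply: eq_bigr => vl vG /=.
  have [_ _ _ HPQ4] := HPQ vl vG.
  rewrite -HPQ4 ?(QO x)//; last by case: Ox.
  rewrite retractE// exprMn -mulrA -exprD subnKC; first by rewrite mulrC.
  by rewrite -ltnS.
Qed.


Lemma growth_inequality_chart (W0 : {set W}) :
  (forall w, w \in W0 -> exists y : V -> X,
     (forall v, Z (c' v) (y v)) /\ ~ Theta w y) ->
  exists D, forall N,
  (\prod_(v in Gd) mrank (xi (i v)) (Z (c v) `&` U (i v)) N * N.+1 ^ #|W0|
   <= \prod_v growth (c' v) (D * N))%N.
Proof.
move=> properT; have [j [y0 [E [Py0 HE]]]] := mrank_retraction.
have [|E' HE'] := mrank_conditions (enum_uniq (mem W0)) Py0.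
  by move=> w; rewrite mem_enum; exact: properT.
exists (E' * E.+1)%N => N; apply: leq_trans (leq_mul (HE N) (leqnn _)) _.
rewrite mulnC; have := HE' (E.+1 * N)%N; rewrite -cardE => HN.
apply: (@leq_trans (mrank (prod_coord (fun v => xi (j v)))
    (chart_piece c' j) (E' * (E.+1 * N)))).
  apply: leq_trans HN; apply: leq_mul; last first.
    by apply: rank_subset => y [Py Ty]; split=> // w _; exact: Ty.
  by case: #|W0| => // m; rewrite leq_exp2r// ltnS leq_pmull.
rewrite -mulnA.
apply: leq_trans (mrank_prod_le (fun v => xi (j v))
  (fun v => Z (c' v) `&` U (j v)) _) _.
by apply: leq_prod => v _; exact: (leq_bigmax (j v)).
Qed.

End Source.

(** Here T c is a component of X^V that contains the image by f of the
    component c.  As g maps the component T c into a single component, which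
    contains the component c as far as the coordinates in Gd are concerned,
    maximality of the components shows that T c determines c on Gd.  On a
    window where T c follows the pattern p w the condition Theta w is proper,
    and costs a linear factor. *)
Lemma growth_inequality (p : W -> V -> C) :
  (forall w x, Theta w (f x)) ->
  (forall w (c : V -> C), (forall v, v \in Nb w -> c v = p w v) ->
     exists y : V -> X, (forall v, Z (c v) (y v)) /\ ~ Theta w y) ->
  exists T : {ffun V -> C} -> {ffun V -> C},
    (forall c c', T c = T c' -> forall v, v \in Gd -> c v = c' v) /\
    exists D, forall N (c : {ffun V -> C}),
      (\prod_(v in Gd) growth (c v) N *
         N.+1 ^ #|[set w | [forall v in Nb w, T c v == p w v]]%SET|
       <= \prod_v growth (T c v) (D * N))%N.
Proof.
move=> f_Theta properT.
have /choice[T HT] (c : {ffun V -> C}) : exists c' : {ffun V -> C},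
    forall x : V -> X, (forall v, Z (c v) (x v)) -> forall v, Z (c' v) (f x v).
  have [c' Hc'] := box_component c morph_f; exists [ffun v => c' v] => x Zx v.
  by rewrite ffunE; exact: Hc'.
exists T; split=> [c c' Tcc' v vG|].
  have [e He] := box_component (T c) morph_g.
  have sub (d : {ffun V -> C}) : T d = T c -> d v = e v.
    move=> Td; apply: antichainZ => z Zz.
    have /choice[x Zx] v' : exists x, Z (d v') x by have [] := irrZ (d v').
    have Zxz v' : Z (d v') (set_coord x v z v').
      by rewrite /set_coord; case: eqP => [->|].
    have Hx := HT d _ Zxz; rewrite Td in Hx.
    by have := He _ Hx v; rewrite retractE// /set_coord eqxx.
  by rewrite (sub c)// (sub c').
pose P (ci : {ffun V -> C} * {ffun V -> J}) D :=
  (forall v, Z (ci.1 v) `&` U (ci.2 v) !=set0) -> forall N,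
  (\prod_(v in Gd) mrank (xi (ci.2 v)) (Z (ci.1 v) `&` U (ci.2 v)) N *
     N.+1 ^ #|[set w | [forall v in Nb w, T ci.1 v == p w v]]%SET|
   <= \prod_v growth (T ci.1 v) (D * N))%N.
have [D HD] : exists D, forall ci, P ci D.
  apply: finite_bound => [ci m n mn Pm /Pm Hm N|[c i]].
    apply: leq_trans (Hm N) _; apply: leq_prod => v _; apply: growth_mono.
    by rewrite leq_mul2r mn orbT.
  have [meet|] := pselect (forall v, Z (c v) `&` U (i v) !=set0); last by exists 0%N.
  have [|D HD] := growth_inequality_chart (W0 :=
      [set w | [forall v in Nb w, T c v == p w v]]%SET) (HT c) f_Theta meet.
    move=> w; rewrite inE => /forall_inP pw; apply: properT => v vw.
    exact/eqP/pw.
  by exists D => _; exact: HD.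
exists D => N c.
have /choice[i Hi] v : exists j, Z (c v) `&` U j !=set0 /\
    growth (c v) N = mrank (xi j) (Z (c v) `&` U j) N.
  have [[x Zx] _] := irrZ (c v); have [j0 _] := coverU x.
  have [j _ jE] := eq_bigmax_cond (A := J)
    (fun j => mrank (xi j) (Z (c v) `&` U j) N)
    (ltac:(by apply/card_gt0P; exists j0)).
  exists j; split; last exact: jE.
  have := growth_gt0 (c v) N; rewrite /growth jE.
  exact: rank_gt0_nonempty.
under eq_bigr => v _ do have [_ ->] := Hi v.
have := HD (c, [ffun v => i v]); rewrite /P /= => /(_ _ N) {}HD.
under eq_bigr => v _ do rewrite -[i v](ffunE i).
by apply: HD => v; rewrite ffunE; case: (Hi v).
Qed.

End Retraction.
End Geometry.

(** * Counting patterns of components *)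

Section Counting.
Variable R : archiRcfType.

Lemma root_exists (y : R) J : (0 < J)%N -> 0 <= y ->
  exists2 u : R, 0 <= u & u ^+ J = y.
Proof.
move=> J0 y0; have [||x] := @poly_ivt R ('X^J - y%:P) 0 (y + 1).
- by rewrite addr_ge0.
- rewrite !hornerE expr0n gtn_eqF// sub0r oppr_le0 y0 subr_ge0.
  have y1 : y <= y + 1 by rewrite lerDl.
  by rewrite (le_trans y1)// ler_eXnr// lerDr.
- move=> /andP[x0 _].
  by rewrite /root !hornerE subr_eq0 => /eqP xJ; exists x.
Qed.

(** Bernoulli's inequality. *)
Lemma pow_unbounded (x y : R) : 0 < x -> exists m, forall n, (m <= n)%N -> y <= (1 + x) ^+ n.
Proof.
move=> x0; have bern n : 1 + x *+ n <= (1 + x) ^+ n.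
  elim: n => [|n IHn]; first by rewrite mulr0n addr0 expr0.
  rewrite exprS mulrS.
  have := ler_wpM2l (ltac:(by rewrite addr_ge0 // ltW) : 0 <= 1 + x) IHn.
  apply: le_trans; have : 0 <= x *+ n by rewrite mulrn_wge0// ltW.
  by move: (x *+ n) => y'; nra.
exists (Num.bound `|y / x|) => n mn; apply: le_trans (bern n).
have : y / x < n%:R.
  apply: le_lt_trans (ler_norm _) _.
  by apply: lt_le_trans (archi_boundP (normr_ge0 _)) _; rewrite ler_nat.
rewrite ltr_pdivrMr// mulr_natl => /ltW /le_trans; apply.
by rewrite lerDr.
Qed.

Section PatternSum.
Variables (C V W : finType) (Nb : W -> {set V}) (p : W -> V -> C).
Variables (u : C -> R) (B : R) (a : nat).
Hypothesis disjNb : forall w w' v, v \in Nb w -> v \in Nb w' -> w = w'.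
Hypothesis cardNb : forall w, (#|Nb w| <= a)%N.
Hypothesis uB : forall c, 1 <= u c <= B.

Definition matches (c : {ffun V -> C}) (w : W) : bool :=
  [forall v in Nb w, c v == p w v].

(** The patterns lose half of their weight for each bad window in r, and the
    windows are taken into account one by one. *)
Definition pattern_sum (r : seq W) : R :=
  \sum_(c : {ffun V -> C})
    (\prod_(w <- r) (if matches c w then 2^-1 else 1)) * \prod_v u (c v).

Hypothesis B_ge1 : 1 <= B.
Hypothesis C_gt0 : (0 < #|C|)%N.

Lemma u_ge0 c : 0 <= u c.
Proof. by case/andP: (uB c) => /(le_trans ler01). Qed.

Lemma prod_u_ge1 (P : pred V) (c : V -> C) : 1 <= \prod_(v | P v) u (c v).
Proof.
apply: (big_ind (fun y => 1 <= y)) => // [y z|v _]; first exact: mulr_ege1.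
by case/andP: (uB (c v)).
Qed.

Lemma prod_u_le (P : pred V) (c : V -> C) :
  \prod_(v | P v) u (c v) <= B ^+ #|P|.
Proof.
rewrite -prodr_const; apply: ler_prod => v _.
by rewrite u_ge0; case/andP: (uB (c v)).
Qed.

(** To overwrite a pattern by p w on the block of w is at most #|C| ^ a to one
    and divides the weight by at most B ^ a, while the other blocks are not
    affected; so the patterns that match p w carry at least a fixed proportion
    of the total weight. *)
Lemma pattern_sum_step w r : w \notin r ->
  pattern_sum (w :: r) <=
  (1 - (2 * (#|C|%:R * B) ^+ a)^-1) * pattern_sum r.
Proof.
move=> wr; pose F r (c : {ffun V -> C}) :=
  (\prod_(w <- r) (if matches c w then 2^-1 else 1)) * \prod_v u (c v).
have KB_gt0 : 0 < #|C|%:R * B by rewrite mulr_gt0 ?ltr0n// (lt_le_trans ltr01).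
have F_ge0 r' c : 0 <= F r' c.
  rewrite mulr_ge0//; last by apply: prodr_ge0 => v _; exact: u_ge0.
  by apply: prodr_ge0 => w' _; case: ifP => _ //; rewrite invr_ge0.
pose M := \sum_(c | matches c w) F r c.
have -> : pattern_sum (w :: r) = pattern_sum r - 2^-1 * M.
  rewrite /pattern_sum /M [in X in _ = _ - X]big_mkcond mulr_sumr -sumrB.
  apply: eq_bigr => c _; rewrite big_cons -mulrA -/(F r c).
  by case: ifP => _; [lra|rewrite mul1r mulr0 subr0].
suff SM : pattern_sum r <= (#|C|%:R * B) ^+ a * M.
  rewrite mulrBl mul1r lerD2l lerN2 invfM -mulrA ler_pM2l ?invr_gt0//.
  by rewrite mulrC ler_pdivrMr ?exprn_gt0// mulrC.
pose tau (c : {ffun V -> C}) := [ffun v => if v \in Nb w then p w v else c v].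
rewrite /pattern_sum (partition_big tau (matches^~ w)) /=; last first.
  by move=> c _; apply/forall_inP => v vw; rewrite ffunE vw.
rewrite mulr_sumr; apply: ler_sum => c' _.
have tauE c v : tau c == c' -> v \notin Nb w -> c v = c' v.
  by move=> /eqP <- /negPf vw; rewrite ffunE vw.
have FB c : tau c == c' -> F r c <= B ^+ a * F r c'.
  move=> cc'; rewrite /F mulrCA.
  have -> : \prod_(w <- r) (if matches c w then 2^-1 else 1) =
      \prod_(w <- r) (if matches c' w then 2^-1 else 1) :> R.
    apply: eq_big_seq => w' w'r; congr (if _ then _ else _).
    apply: eq_forallb_in => v vw'; rewrite (tauE c)//.
    by apply: contraNN wr => vw; rewrite (disjNb vw vw').
  apply: ler_wpM2l.
    by apply: prodr_ge0 => w' _; case: ifP => _ //; rewrite invr_ge0.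
  rewrite (bigID (mem (Nb w))) [X in _ <= _ * X](bigID (mem (Nb w))) /= mulrA.
  rewrite (eq_bigr (fun v => u (c' v)) (P := fun v => v \notin Nb w)); last first.
    by move=> v /(tauE c _ cc')->.
  apply: ler_wpM2r; first by apply: prodr_ge0 => v _; exact: u_ge0.
  apply: (le_trans (prod_u_le _ _)); apply: (@le_trans _ _ (B ^+ a)).
    by apply: ler_weXn2l => //; exact: cardNb.
  by rewrite ler_peMr ?prod_u_ge1// exprn_ge0// (le_trans ler01).
apply: (@le_trans _ _ (\sum_(c | tau c == c') B ^+ a * F r c')).
  by apply: ler_sum => c; exact: FB.
rewrite sumr_const -[leLHS]mulr_natl exprMn -mulrA ler_wpM2r//.
  by rewrite mulr_ge0 ?exprn_ge0// (le_trans ler01).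
rewrite -natrX ler_nat.
pose S v : {set C} := if v \in Nb w then finset.setT else [set c' v]%SET.
apply: (@leq_trans #|[set b : {ffun V -> C} in family (fun v => mem (S v))]%SET|).
  apply: subset_leq_card; apply/fintype.subsetP => c cc'; rewrite inE.
  apply/familyP => v; rewrite /S; case: ifP => vw; first by rewrite inE.
  by rewrite inE (tauE c)// vw.
rewrite card_family_set (bigID (mem (Nb w))) /= [X in (_ * X)%N]big1; last first.
  by move=> v vw; rewrite /S (negPf vw) cards1.
rewrite muln1 (eq_bigr (fun=> #|C|)); last by move=> v vw; rewrite /S vw cardsT.
by rewrite prod_nat_const leq_pexp2l.
Qed.

Lemma pattern_sum_le :
  pattern_sum (enum W) <=
  (1 - (2 * (#|C|%:R * B) ^+ a)^-1) ^+ #|W| * pattern_sum [::].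
Proof.
have KB_ge1 : 1 <= (#|C|%:R * B) ^+ a.
  by rewrite exprn_ege1// mulr_ege1// ler1n.
have x_le1 : 0 <= 1 - (2 * (#|C|%:R * B) ^+ a)^-1.
  by rewrite subr_ge0 invf_le1; lra.
rewrite [#|W|]cardE; elim: (enum W) (enum_uniq W) => [_|w r IHr /= /andP[wr ur]].
  by rewrite expr0 mul1r.
apply: (le_trans (pattern_sum_step wr)); rewrite exprS -mulrA.
exact: ler_wpM2l (IHr ur).
Qed.

Lemma pattern_sum_weight : pattern_sum (enum W) =
  \sum_(c : {ffun V -> C}) 2^-1 ^+ #|[set w | matches c w]%SET| * \prod_v u (c v).
Proof.
apply: eq_bigr => c _; congr *%R; rewrite big_enum -big_mkcond /=.
by rewrite prodr_const; congr (_ ^+ _); apply: eq_card => w; rewrite !inE.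
Qed.

End PatternSum.

(** A faster growth at all large scales would exceed the polynomial bound on
    the h c. *)
Lemma stable_scale (C : finType) (h : C -> nat -> nat) (n D : nat) :
  (forall c N, 0 < h c N <= N.+1 ^ n)%N ->
  (forall c N N', N <= N' -> h c N <= h c N')%N ->
  exists kappa, forall m0, exists m, [/\ (0 < m)%N, (m0 <= m)%N &
    forall c, (h c (D * 2 ^ m) <= kappa * h c (2 ^ m))%N].
Proof.
move=> hn hmono; pose d := D.+1; pose K := #|C|.
exists (2 ^ (d * n * K).+1)%N => m0; set kappa := (2 ^ _)%N.
(* From one j to the next one, the polynomial bound on the product H of all
   the h c at the scale 2 ^ (d * j) is multiplied by 2 ^ (d * n * K), that is
   by half of kappa. *)
pose H j := (\prod_c h c (2 ^ (d * j)))%N.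
have H_gt0 j : (0 < H j)%N by apply: prodn_gt0 => c; case/andP: (hn c (2 ^ (d * j))%N).
have H_le j : (H j <= 2 ^ ((d * j).+1 * (n * K)))%N.
  rewrite [leqRHS]expnM [leqRHS]expnM -prod_nat_const; apply: leq_prod => c _.
  case/andP: (hn c (2 ^ (d * j))%N) => _ /leq_trans; apply.
  case: (n) => // n'; rewrite leq_exp2r// expnS mul2n -addnn -addn1.
  by rewrite leq_add2l expn_gt0.
have [j j0 Hj] : exists2 j, (m0 < j)%N & (H j.+1 <= kappa * H j)%N.
  apply: contrapT => nj.
  have fast j : (m0 < j)%N -> (kappa * H j < H j.+1)%N.
    by move=> lt; rewrite ltnNge; apply/negP => le; apply: nj; exists j.
  have pow r : (kappa ^ r <= H (m0.+1 + r))%N.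
    elim: r => [|r IHr]; first exact: H_gt0.
    rewrite expnS addnS; apply: leq_trans (ltnW (fast _ _)).
      by rewrite leq_mul.
    by rewrite addSn ltnS leq_addr.
  pose r := ((d * m0.+1).+1 * (n * K)).+1.
  have := leq_trans (pow r) (H_le _); rewrite /kappa -expnM leq_exp2l//.
  rewrite leqNgt => /negP; apply.
  have -> : ((d * (m0.+1 + r)).+1 * (n * K) =
      (d * m0.+1).+1 * (n * K) + d * n * K * r)%N.
    rewrite mulnDr -addSn mulnDl; congr addn; rewrite -!mulnA; congr muln.
    by rewrite mulnC -mulnA.
  by rewrite [ltnRHS]mulSn ltn_add2r.
have j_gt0 : (0 < j)%N by exact: leq_ltn_trans j0.
exists (d * j)%N; split=> [||c].
- by rewrite muln_gt0.
- by rewrite (leq_trans (ltnW j0))// leq_pmull.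
apply: (@leq_trans (h c (2 ^ (d * j.+1))%N)).
  apply: hmono; rewrite mulnS expnD leq_mul//.
  by rewrite ltnW// (leq_trans (ltn_expl D (ltnSn 1)))// leq_exp2l// leqnSn.
pose P := (\prod_(c' | c' != c) h c' (2 ^ (d * j)))%N.
have P_gt0 : (0 < P)%N by apply: prodn_gt0 => c'; case/andP: (hn c' (2 ^ (d * j))%N).
have HjE : H j = (h c (2 ^ (d * j)) * P)%N by rewrite /H (bigD1 c).
rewrite -(leq_pmul2r P_gt0) -mulnA -HjE; apply: leq_trans Hj.
rewrite /H [leqRHS](bigD1 c)//= leq_mul//; apply: leq_prod => c' _.
by apply: hmono; rewrite leq_exp2l// leq_mul.
Qed.

(** The weights u c are the m-th roots of the growths h c at a stable scale
    2 ^ m: they are bounded independently of V, a factor N in the growth becomes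
    a factor 2 in the weight, and the constants kappa become negligible.  Then
    the total weight of all patterns of components is compared with itself
    through T: there is a loss of a fixed factor for each window in W, and a
    gain of at most a fixed factor for each coordinate outside Gd. *)
Lemma growth_contradiction (C : finType) (h : C -> nat -> nat) (n a : nat) :
  (0 < #|C|)%N ->
  (forall c N, 0 < h c N <= N.+1 ^ n)%N ->
  (forall c N N', N <= N' -> h c N <= h c N')%N ->
  exists q, forall (V W : finType) (Nb : W -> {set V}) (p : W -> V -> C)
    (Gd : {set V}) (T : {ffun V -> C} -> {ffun V -> C}) (D : nat),
  (forall w w' v, v \in Nb w -> v \in Nb w' -> w = w') ->
  (forall w, #|Nb w| <= a)%N ->
  (forall c c', T c = T c' -> forall v, v \in Gd -> c v = c' v) ->
  (forall N (c : {ffun V -> C}),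
      (\prod_(v in Gd) h (c v) N *
         N.+1 ^ #|[set w | matches Nb p (T c) w]%SET|
       <= \prod_v h (T c v) (D * N))%N) ->
  ~ (q * #|~: Gd| < #|W|)%N.
Proof.
move=> C_gt0 hn hmono; pose B : R := 4 ^+ n.
have B_ge1 : 1 <= B by rewrite exprn_ege1// ler1n.
have KB_ge1 : 1 <= #|C|%:R * B by rewrite mulr_ege1// ler1n.
have KB_gt0 : 0 < #|C|%:R * B by exact: lt_le_trans KB_ge1.
pose x : R := (2 * (#|C|%:R * B) ^+ a)^-1.
have [x_gt0 x_le] : 0 < x /\ x <= 2^-1.
  have := exprn_ege1 a KB_ge1; rewrite /x; move: (_ ^+ a) => y y1.
  by split; [rewrite invr_gt0; lra|rewrite lef_pV2 ?posrE; lra].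
have x1_ge0 : 0 <= 1 + x by rewrite addr_ge0// ltW.
have B_ge0 : 0 <= B by exact: le_trans ler01 B_ge1.
have KB_ge0 : 0 <= #|C|%:R * B by exact: ltW.
(* The loss is 1 - x for each window, and 1 + x is the allowance for kappa;
   since there is at least one window, rho = (1 + x) (1 - x) can be counted as
   the loss for each window, and q losses make up for one bad coordinate. *)
pose rho := 1 - x ^+ 2.
have [rho_gt0 rho_lt1] : 0 < rho /\ rho < 1.
  by rewrite /rho; split; [nra|rewrite gtrBl exprn_gt0].
have [q Hq] : exists q, #|C|%:R * B * rho ^+ q <= 1.
  have y_gt0 : 0 < rho^-1 - 1 by rewrite subr_gt0 invf_gt1.
  have [q /(_ q (leqnn _))] := pow_unbounded (#|C|%:R * B) y_gt0.
  rewrite addrC subrK exprVn => Hq; exists q.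
  by rewrite -ler_pdivlMr ?exprn_gt0// mul1r.
exists q => V W Nb p Gd T D disjNb cardNb injT growthT qW.
have [kappa Hkappa] := stable_scale D hn hmono.
have [m0 Hm0] := pow_unbounded (kappa%:R ^+ #|V|) x_gt0.
have [m [m_gt0 m0m Hm]] := Hkappa m0.
have /choice[u Hu] c : exists u : R, 0 <= u /\ u ^+ m = (h c (2 ^ m)%N)%:R.
  have [u u0 um] := root_exists m_gt0 (ler0n R (h c (2 ^ m)%N)).
  by exists u.
have u0 c : 0 <= u c by case: (Hu c).
have um c : u c ^+ m = (h c (2 ^ m)%N)%:R by case: (Hu c).
have uB c : 1 <= u c <= B.
  have /andP[h_gt0 h_le] := hn c (2 ^ m)%N; apply/andP; split.
    by rewrite -(ler_pXn2r m_gt0) ?nnegrE// expr1n um ler1n.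
  rewrite -(ler_pXn2r m_gt0) ?nnegrE ?exprn_ge0// um /B -exprM mulnC exprM.
  rewrite -!natrX ler_nat (leq_trans h_le)//; case: (n) => // n'.
  rewrite leq_exp2r// -[4%N]/(2 * 2)%N expnMn.
  have : (1 < 2 ^ m)%N by rewrite -{1}(expn0 2) ltn_exp2l.
  move: (2 ^ m)%N => y y1; apply: (@leq_trans (2 * y)).
    by rewrite mul2n -addnn -addn1 leq_add2l ltnW.
  by rewrite leq_mul2r y1 orbT.
pose b c := #|[set w | matches Nb p c w]%SET|.
have weightT (c : {ffun V -> C}) : (\prod_(v in Gd) u (c v)) * 2 ^+ b (T c) <=
    (1 + x) * \prod_v u (T c v).
  have prod_ge0 (P : pred V) (c' : V -> C) : 0 <= \prod_(v | P v) u (c' v).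
    by apply: prodr_ge0.
  rewrite -(ler_pXn2r m_gt0) ?nnegrE ?mulr_ge0 ?exprn_ge0//.
  have prodX (P : pred V) (c' : V -> C) : (\prod_(v | P v) u (c' v)) ^+ m =
      (\prod_(v | P v) h (c' v) (2 ^ m)%N)%:R.
    by rewrite -prodrXl natr_prod; apply: eq_bigr => v _; exact: um.
  rewrite !exprMn !prodX -exprM [(b _ * m)%N]mulnC exprM -!natrX -natrM.
  apply: (@le_trans _ _ (kappa%:R ^+ #|V| * (\prod_v h (T c v) (2 ^ m)%N)%:R)).
    rewrite -natrX -natrM ler_nat.
    apply: (@leq_trans (\prod_v h (T c v) (D * 2 ^ m))%N).
      apply: leq_trans (growthT _ c); rewrite leq_mul//.
      by rewrite -/(b (T c)); case: (b (T c)) => // b'; rewrite leq_exp2r.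
    rewrite -prod_nat_const -big_split; apply: leq_prod => v _; exact: Hm.
  by rewrite ler_wpM2r// Hm0.
have total : pattern_sum Nb p u [::] <= (#|C|%:R * B) ^+ #|~: Gd| * (1 + x) *
    pattern_sum Nb p u (enum W).
  rewrite pattern_sum_weight mulr_sumr.
  rewrite /pattern_sum (partition_big T predT)//=; apply: ler_sum => c' _.
  apply: (@le_trans _ _ (\sum_(c | T c == c')
      B ^+ #|~: Gd| * ((1 + x) * (2^-1 ^+ b c' * \prod_v u (c' v))))).
    apply: ler_sum => c /eqP <-; rewrite big_nil mul1r (bigID (mem (~: Gd))) /=.
    apply: ler_pM.
    - by apply: prodr_ge0.
    - by apply: prodr_ge0.
    - exact: prod_u_le.
    - rewrite mulrCA exprVn ler_pdivlMl ?exprn_gt0// mulrC.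
      apply: le_trans (weightT c); rewrite ler_wpM2r ?exprn_ge0//.
      by rewrite (eq_bigl (mem Gd))// => v; rewrite inE negbK.
  rewrite sumr_const -[leLHS]mulr_natl exprMn -!mulrA ler_wpM2r//.
    by rewrite !mulr_ge0 ?exprn_ge0 ?invr_ge0 ?prodr_ge0.
  rewrite -natrX ler_nat.
  have [[c0 Tc0]|noc] := pselect (exists c0, T c0 = c'); last first.
    rewrite eq_card0// => c; apply/negP => Tc; apply: noc; exists c.
    by apply/eqP; exact: Tc.
  pose S v : {set C} := if v \in Gd then [set c0 v]%SET else finset.setT.
  apply: (@leq_trans #|[set b : {ffun V -> C} in family (fun v => mem (S v))]%SET|).
    apply: subset_leq_card; apply/fintype.subsetP => c Tc; rewrite inE.
    apply/familyP => v; rewrite /S; case: ifP => vG; last by rewrite inE.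
    by rewrite inE (injT c c0)// Tc0; apply/eqP; exact: Tc.
  rewrite card_family_set (bigID (mem Gd)) /= big1 ?mul1n; last first.
    by move=> v vG; rewrite /S vG cards1.
  rewrite (eq_bigr (fun=> #|C|)); last by move=> v /negPf vG; rewrite /S vG cardsT.
  rewrite (eq_bigl (mem (~: Gd))) ?prod_nat_const// => v.
  by rewrite !inE.
have S_gt0 : 0 < pattern_sum Nb p u [::].
  have /card_gt0P[c0 _] := C_gt0.
  rewrite /pattern_sum (bigD1 [ffun=> c0])//= ltr_pwDl//.
    by rewrite big_nil mul1r (lt_le_trans ltr01)//; exact: (prod_u_ge1 uB).
  apply: sumr_ge0 => c _; rewrite big_nil mul1r; exact: prodr_ge0.
have W_gt0 : (0 < #|W|)%N by exact: leq_ltn_trans qW.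
have := pattern_sum_le p disjNb cardNb uB B_ge1 C_gt0; rewrite -/x => le_sum.
have KBx_ge0 : 0 <= (#|C|%:R * B) ^+ #|~: Gd| * (1 + x).
  by rewrite mulr_ge0 ?exprn_ge0.
have := le_trans total (ler_wpM2l KBx_ge0 le_sum).
rewrite mulrA ler_pMl// leNgt => /negP; apply.
apply: (@le_lt_trans _ _ ((#|C|%:R * B) ^+ #|~: Gd| * rho ^+ #|W|)).
  rewrite -mulrA ler_wpM2l ?exprn_ge0//.
  have -> : rho = (1 + x) * (1 - x) by rewrite /rho; ring.
  rewrite exprMn ler_wpM2r ?exprn_ge0//; first by lra.
  by rewrite ler_eXnr//; lra.
rewrite -(subnKC (ltnW qW)) exprD mulrA mulnC [(_ * q)%N]mulnC exprM -exprMn.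
apply: (@le_lt_trans _ _ (1 * rho ^+ (#|W| - q * #|~: Gd|))).
  by rewrite ler_wpM2r ?exprn_ile1 ?mulr_ge0 ?exprn_ge0// ltW.
by rewrite mul1r exprn_ilt1// ?subn_eq0 -?ltnNge// ltW.
Qed.

End Counting.

(** * Packings in sofic approximations *)

Section Packing.
Variable G : groupType.

(** The part of the right regular action of G that survives on a finite set;
    each point of W is the centre of an isolated copy of K. *)
Definition packing (K : {fset G}) (V : finType) (act : V -> G -> V)
    (Gd W : {set V}) : Prop :=
  [/\ forall v g h, v \in Gd -> g \in K -> h \in K ->
        act (act v g) h = act v (g * h)%g,
      forall v, v \in Gd -> act v 1%g = v,
      forall w, w \in W -> w \in Gd /\ forall g, g \in K -> act w g \in Gd &
      forall w w' g g', w \in W -> w' \in W -> g \in K -> g' \in K ->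
        act w g = act w' g' -> w = w' /\ g = g'].

Lemma leq_card_bigcup (V L : finType) (P : pred L) (A : L -> {set V}) :
  (#|(\bigcup_(l | P l) A l)%SET| <= \sum_(l | P l) #|A l|)%N.
Proof.
elim/big_rec2: _ => [|l n S _ Sn]; first by rewrite cards0.
by rewrite (leq_trans (leq_card_setU _ _).1)// leq_add2l.
Qed.

(** A maximal family of disjoint translates of K among the points that are far
    from bad ones: every such point is excluded by some centre, and a centre
    excludes at most the square of #|K| points, so the centres have a density
    that does not depend on the quality of the approximation. The right action
    is v g = phi (g^-1) v. *)
Lemma sofic_packing (R : realType) (K : {fset G}) (q : nat) :
  sofic R G -> 1%g \in K -> exists (V : finType) (act : V -> G -> V)
    (Gd W : {set V}), packing K act Gd W /\ (q * #|~: Gd| < #|W|)%N.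
Proof.
move=> soficG K1; pose c := #|` K|.
(* With precision 1 / L, each of the 2 c ^ 2 requirements on points fails for at
   most n / L of the n points, so (c + q c ^ 2) times the number of bad points
   stays below n. *)
pose L := (2 * c ^ 2 * (c + q * c ^ 2)).+1.
have L_gt0 : 0 < (L%:R : R) by rewrite ltr0n.
have eps_gt0 : 0 < (L%:R^-1 : R) by rewrite invr_gt0.
have [n [phi [n_gt0 phiM phi_free]]] :=
  soficG [fset (g^-1)%g | g in K]%fset _ eps_gt0.
have KV g : g \in K -> (g^-1)%g \in [fset (g^-1)%g | g in K]%fset.
  by move=> gK; apply: in_imfset.
pose act (v : 'I_n) g := phi (g^-1)%g v.
have act_inj g : injective (act^~ g) by exact: perm_inj.
pose B1 (gh : K * K) := [set v | act (act v (val gh.1)) (val gh.2) !=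
  act v (val gh.1 * val gh.2)%g]%SET.
pose B2 (gh : K * K) := [set v | (val gh.1 != val gh.2) &&
  (act v (val gh.1) == act v (val gh.2))]%SET.
have n_gt0R : 0 < (n%:R : R) by rewrite ltr0n.
have hamming_le m : (m%:R / n%:R <= L%:R^-1 :> R) -> (L * m <= n)%N.
  rewrite ler_pdivrMr// mulrC ler_pdivlMr// => le.
  by rewrite -(ler_nat R) natrM mulrC.
have cardB1 gh : (L * #|B1 gh| <= n)%N.
  case: gh => g h; apply: hamming_le.
  have := phiM _ _ (KV _ (valP h)) (KV _ (valP g)); apply: le_trans.
  rewrite /hamming ler_pM2r ?invr_gt0// ler_nat.
  apply: subset_leq_card; apply/fintype.subsetP => v.
  by rewrite !inE /= /act permM invgM eq_sym.
have cardB2 gh : (L * #|B2 gh| <= n)%N.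
  case: gh => g h; have [gh|gh] := eqVneq (val g) (val h).
    have -> : B2 (g, h) = finset.set0.
      by apply/finset.setP => v; rewrite !inE /= gh eqxx.
    by rewrite cards0 muln0.
  apply: hamming_le.
  have gh' : (val g)^-1%g <> (val h)^-1%g by move/invg_inj/eqP; apply/negP.
  have := phi_free _ _ (KV _ (valP g)) (KV _ (valP h)) gh'.
  rewrite lerBlDr -lerBlDl; apply: le_trans.
  set S := B2 _; rewrite /hamming.
  have -> : #|[pred v | phi (val g)^-1%g v != phi (val h)^-1%g v]| = (n - #|S|)%N.
    rewrite (_ : #|_| = #|~: S|); first by rewrite cardsCs finset.setCK card_ord.
    by apply: eq_card => v; rewrite !inE /= gh.
  have Sn : (#|S| <= n)%N by rewrite -[leqRHS]card_ord max_card.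
  by rewrite natrB// mulrBl divff ?gt_eqF// subKr.
pose Gd := (~: \bigcup_(gh : K * K) (B1 gh :|: B2 gh))%SET.
have cardGd : (L * #|~: Gd| <= 2 * c ^ 2 * n)%N.
  rewrite finset.setCK; apply: (@leq_trans (L * \sum_(gh : K * K) (#|B1 gh| + #|B2 gh|))).
    rewrite leq_mul2l /=; apply: leq_trans (leq_card_bigcup _ _) _.
    by apply: leq_sum => gh _; exact: (leq_card_setU _ _).1.
  rewrite big_distrr /=; apply: (@leq_trans (\sum_(gh : K * K) (2 * n))).
    by apply: leq_sum => gh _; rewrite mulnDr mul2n -addnn leq_add.
  by rewrite sum_nat_const card_prod -cardfE mulnCA mulnA mulnn.
have GdM v g h : v \in Gd -> g \in K -> h \in K ->
    act (act v g) h = act v (g * h)%g.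
  move=> + gK hK; rewrite inE => /bigcupP nv; apply/eqP/negPn/negP => neq.
  by apply: nv; exists ([` gK]%fset, [` hK]%fset); rewrite // !inE neq.
have GdI v g h : v \in Gd -> g \in K -> h \in K -> act v g = act v h -> g = h.
  move=> + gK hK; rewrite inE => /bigcupP nv eq; apply/eqP/negPn/negP => neq.
  by apply: nv; exists ([` gK]%fset, [` hK]%fset); rewrite // !inE /= neq eq eqxx orbT.
have Gd1 v : v \in Gd -> act v 1%g = v.
  by move=> vG; apply: (@act_inj 1%g); rewrite /= GdM// mulg1.
pose Vg := [set v | [forall g : K, act v (val g) \in Gd]]%SET.
have Vg1 v : v \in Vg -> v \in Gd.
  rewrite inE => /forallP/(_ [` K1]%fset) /= v1.
  by have /act_inj <- := Gd1 _ v1.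
pose P (S : {set 'I_n}) := (S \subset Vg) &&
  [forall w in S, forall w' in S, forall g : K, forall g' : K,
    (act w (val g) == act w' (val g')) ==> (w == w')].
have P0 : P finset.set0.
  by rewrite /P finset.sub0set; apply/forall_inP => w; rewrite inE.
have [W /maxsetP[/andP[WV /forall_inP disjW] maxW] _] := maxset_exists P0.
have cover : (Vg \subset \bigcup_(x : 'I_n * (K * K) | x.1 \in W)
    [set v | act v (val x.2.1) == act x.1 (val x.2.2)])%SET.
  apply/fintype.subsetP => v vV; apply/bigcupP.
  have [vW|vW] := boolP (v \in W).
    by exists (v, ([` K1], [` K1])%fset) => //; rewrite inE.
  have : ~ P (v |: W)%SET.
    move=> PvW; have := maxW _ PvW (finset.subsetUr _ _).
    by move/setP/(_ v); rewrite finset.setU11 (negPf vW).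
  move=> nP; apply: contrapT => free; apply: nP; apply/andP; split.
    by rewrite finset.subUset finset.sub1set vV.
  have free' w (g g' : K) : w \in W -> act v (val g) == act w (val g') -> False.
    by move=> wW eq; apply: free; exists (w, (g, g')) => //; rewrite inE.
  apply/forall_inP => w wS; apply/forall_inP => w' w'S.
  apply/forallP => g; apply/forallP => g'; apply/implyP => eq.
  move: wS w'S; rewrite !inE => /predU1P[wv|wW] /predU1P[w'v|w'W].
  - by rewrite wv w'v.
  - by case: (free' w' g g' w'W); rewrite -wv.
  - by case: (free' w g' g wW); rewrite -w'v eq_sym.
  - by move/forall_inP: (disjW w wW) => /(_ w' w'W)/forallP/(_ g)/forallP/(_ g')/implyP; apply.
exists 'I_n, act, Gd, W; split.
  split=> // [w wW|w w' g g' wW w'W gK g'K eq].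
    split=> [|g gK]; first exact/Vg1/(fintype.subsetP WV).
    have := fintype.subsetP WV w wW; rewrite inE.
    by move=> /forallP/(_ [` gK]%fset).
  have ww' : w = w'.
    apply/eqP; move/forall_inP: (disjW w wW) => /(_ w' w'W).
    move=> /forallP/(_ [` gK]%fset)/forallP/(_ [` g'K]%fset)/implyP; apply.
    exact/eqP.
  by split=> //; apply: (GdI w) => //; [exact/Vg1/(fintype.subsetP WV)|rewrite eq ww'].
have cardVg : (n <= c * #|~: Gd| + #|Vg|)%N.
  rewrite -[leqLHS]card_ord -cardsT -(finset.setUCr Vg) finset.setUC.
  apply: leq_trans (leq_card_setU _ _).1 _; rewrite leq_add2r.
  have sub : (~: Vg \subset \bigcup_(g : K) [set v | act v (val g) \in ~: Gd])%SET.
    apply/fintype.subsetP => v; rewrite finset.in_setC inE => /forallPn[g ng].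
    by apply/bigcupP; exists g => //; rewrite inE finset.in_setC.
  apply: leq_trans (subset_leq_card sub) _.
  apply: leq_trans (leq_card_bigcup _ _) _.
  rewrite /c cardfE -sum_nat_const; apply: leq_sum => g _.
  rewrite -(card_imset _ (@act_inj (val g))); apply: subset_leq_card.
  by apply/fintype.subsetP => _ /imsetP[v + ->]; rewrite inE.
have cardVW : (#|Vg| <= #|W| * c ^ 2)%N.
  apply: leq_trans (subset_leq_card cover) _.
  apply: leq_trans (leq_card_bigcup _ _) _.
  apply: (@leq_trans (\sum_(x : 'I_n * (K * K) | x.1 \in W) 1)).
    apply: leq_sum => x _; rewrite -(cards1 (act x.1 (val x.2.2))).
    rewrite -(card_imset _ (@act_inj (val x.2.1))); apply: subset_leq_card.
    by apply/fintype.subsetP => _ /imsetP[v + ->]; rewrite !inE.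
  rewrite sum1_card (_ : #|_| = #|finset.setX W [set: K * K]%SET|).
    by rewrite cardsX cardsT card_prod /c cardfE mulnn.
  by apply: eq_card => x; rewrite !inE andbT.
rewrite ltnNge; apply/negP => Wq.
have : (n <= (c + q * c ^ 2) * #|~: Gd|)%N.
  apply: leq_trans cardVg _; rewrite mulnDl leq_add2l; apply: leq_trans cardVW _.
  by rewrite mulnAC leq_mul2r Wq orbT.
rewrite -(leq_pmul2l (ltn0Sn (2 * c ^ 2 * (c + q * c ^ 2)))) -/L mulnCA => le.
have := leq_trans le (leq_mul (leqnn (c + q * c ^ 2)) cardGd).
by rewrite mulnA [X in (_ <= X * n)%N]mulnC leq_pmul2r// ltnn.
Qed.


End Packing.

(** * Automata with finitely many singular cells *)

(** The charts are padded with zero coordinates, because their growths are to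
    be bounded by the same power. *)
Lemma variety_charts (k : closedFieldType) (X : variety k) :
  exists (r n : nat) (U : 'I_r -> set X) (xi : 'I_r -> 'I_n -> X -> k),
    (forall i, chart (U i) (xi i)) /\ forall x, exists i, U i x.
Proof.
have [r [U [affU coverU]]] := variety_affine_cover X.
have /choice[d Hd] i : exists n, exists xi : 'I_n -> X -> k, chart (U i) xi.
  by have [oU /(affine_chart oU)[n [xi Hxi]]] := affU i; exists n, xi.
pose n := (\max_i d i)%N.
have /choice[xi Hxi] i : exists xi : 'I_n -> X -> k, chart (U i) xi.
  by have [xi cxi] := Hd i; apply: chart_widen cxi _; exact: leq_bigmax.
exists r, n, U, xi; split=> // x.
have : [set: X] x by [].
by rewrite -coverU => -[i _ Uix]; exists i.
Qed.

Section Automata.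
Variables (R : realType) (k : closedFieldType) (X : variety k) (G : groupType) (M : {fset G}).
Notation S := (var_morphism (fibre_power M X) X).
Implicit Types s t : G -> S.

Lemma sigmaE s x g : sigma s x g = s g (fun m : M => x (g * val m)%g).
Proof.
by rewrite /sigma; congr (s g _); apply/funext => m; rewrite /translate invgK.
Qed.

Section Model.
Variables (s t : G -> S) (a b : S) (B : {fset G}) (g0 : G) (x0 : G -> X).
Hypothesis st_id : forall x g, sigma s (sigma t x) g = x g.
Hypothesis s_out : forall g, g \notin B -> s g = a.
Hypothesis t_out : forall g, g \notin B -> t g = b.
Hypothesis g0B : g0 \in B.
Hypothesis bad_g0 : sigma t (sigma s x0) g0 <> x0 g0.

Local Open Scope fset_scope.

(** All cells in play are products of at most four letters: an element of B
    followed by at most one step back and two steps forward along M. *)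
Definition letters : {fset G} :=
  (1%g |` (B `|` M)) `|` [fset (m^-1)%g | m in M].
Definition words2 : {fset G} := [fset (g * h)%g | g in letters, h in letters].
Definition words4 : {fset G} := [fset (g * h)%g | g in words2, h in words2].

Lemma letters1 : 1%g \in letters. Proof. by rewrite !inE eqxx. Qed.

Lemma letters_B g : g \in B -> g \in letters.
Proof. by move=> gB; rewrite !inE gB orbT. Qed.

Lemma letters_M (m : M) : val m \in letters.
Proof. by rewrite !inE (valP m) !orbT. Qed.

Lemma letters_MV (m : M) : (val m)^-1%g \in letters.
Proof.
by rewrite 3!inE; apply/orP; right; apply: in_imfset; exact: valP.
Qed.

Lemma words2M g h : g \in letters -> h \in letters -> (g * h)%g \in words2.
Proof. by move=> gL hL; exact: in_imfset2. Qed.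

Lemma words4M g h : g \in words2 -> h \in words2 -> (g * h)%g \in words4.
Proof. by move=> gL hL; exact: in_imfset2. Qed.

Lemma letters_words2 g : g \in letters -> g \in words2.
Proof. by move=> gL; rewrite -[g]mulg1; exact: words2M letters1. Qed.

Lemma words2_words4 g : g \in words2 -> g \in words4.
Proof.
by move=> gL; rewrite -[g]mulg1; apply: words4M => //; exact: letters_words2 letters1.
Qed.

(** The cells on which the value at g0 of sigma t \o sigma s depends. *)
Definition window : {fset G} :=
  g0 |` [fset (g0 * m * m')%g | m in M, m' in M].

Section OnPacking.
Variables (V : finType) (act : V -> G -> V) (Gd W : {set V}).
Hypothesis packed : packing words4 act Gd W.
Hypothesis filler : (forall x g, sigma (fun=> a) (sigma (fun=> b) x) g = x g) \/
  forall v, v \in Gd -> exists w g, [/\ w \in W, g \in B & v = act w g].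
Notation XV := (fibre_power V X).

Local Open Scope set_scope.

(** Copies of B around the points of W, in a constant background. *)
Definition place (s : G -> S) (a : S) (v : V) : S :=
  if [pick wg : V * B | (wg.1 \in W) && (act wg.1 (val wg.2) == v)] is Some wg
  then s (val wg.2) else a.

Definition sigma_on (s : G -> S) (a : S) (x : V -> X) : V -> X :=
  fun v => place s a v (fun m : M => x (act v (val m))).

Lemma place_in (s' : G -> S) (a' : S) w g :
  (forall g, g \notin B -> s' g = a') -> w \in W -> g \in words4 ->
  place s' a' (act w g) = s' g.
Proof.
have [_ _ _ disj] := packed; move=> s'_out wW gK; rewrite /place.
case: pickP => [[w' g'] /= /andP[w'W /eqP eq]|none].
  have g'K : val g' \in words4.
    by apply/words2_words4/letters_words2/letters_B/valP.
  by have [_ <-] := disj _ _ _ _ wW w'W gK g'K (esym eq).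
have [gB|/s'_out->//] := boolP (g \in B).
by have := none (w, [` gB]%fset); rewrite /= wW eqxx.
Qed.

Lemma place_out (s' : G -> S) (a' : S) v :
  (forall w g, w \in W -> g \in B -> act w g <> v) -> place s' a' v = a'.
Proof.
move=> nv; rewrite /place; case: pickP => // -[w g] /= /andP[wW /eqP].
by move=> eq; case: (nv w (val g)) => //; exact: valP.
Qed.

Lemma sigma_on_morphism (s' : G -> S) (a' : S) :
  is_morphism (sigma_on s' a' : XV -> XV).
Proof.
apply/fibre_power_morphism => v.
have ms := mor_morphism (place s' a' v).
apply: (is_morphism_comp ms (h := fun x : XV => (fun m : M => x (act v (val m))) : fibre_power M X)).
apply/fibre_power_morphism => m; exact: is_morphism_proj.
Qed.

Local Notation f := (sigma_on t b).
Local Notation g := (sigma_on s a).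

Lemma sigma_on_in (s' : G -> S) (a' : S) w h (x : V -> X) :
  (forall g, g \notin B -> s' g = a') -> w \in W -> h \in words2 ->
  sigma_on s' a' x (act w h) = s' h (fun m : M => x (act w (h * val m)%g)).
Proof.
move=> s'_out wW hK; have [mul _ WGd _] := packed; rewrite /sigma_on.
rewrite place_in//; last exact: words2_words4.
congr (s' h _); apply/funext => m; rewrite mul//.
- by case: (WGd w wW).
- exact: words2_words4.
- exact/words2_words4/letters_words2/letters_M.
Qed.

(** Around a good point the copied maps look like those of G around some cell,
    or like the background; in both cases the equation holds at this point
    because it holds on G. *)
Lemma sigma_on_retract x v : v \in Gd -> g (f x) v = x v.
Proof.
move=> vG; have [mul one WGd disj] := packed.
have K1 : 1%g \in words4 by apply/words2_words4/letters_words2/letters1.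
have KM (m : M) : val m \in words4.
  exact/words2_words4/letters_words2/letters_M.
have [[w [h [wW hK ->]]]|nv] := pselect (exists w h,
    [/\ w \in W, h \in words2 & v = act w h]).
  have [wG _] := WGd w wW.
  rewrite sigma_on_in// -[RHS](st_id (fun h => x (act w h)) h) sigmaE.
  congr (s h _); apply/funext => m; rewrite sigmaE /sigma_on.
  have hmK : (h * val m)%g \in words4.
    by apply: words4M => //; exact/letters_words2/letters_M.
  rewrite place_in//; congr (t _ _); apply/funext => m'.
  by rewrite mul.
have vWB w h : w \in W -> h \in B -> act w h <> v.
  move=> wW hB eq; apply: nv; exists w, h; split=> //.
  exact/letters_words2/letters_B.
case: filler => [ab_id|/(_ v vG)[w [h [wW hB eq]]]]; last by case: (vWB w h).
rewrite /sigma_on place_out//.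
transitivity (a (fun m : M => b (fun m' : M => x (act v (val m * val m')%g)))).
  congr (a _); apply/funext => m; rewrite place_out.
    by congr (b _); apply/funext => m'; rewrite mul.
  move=> w h wW hB eq; apply: nv; exists w, (h * (val m)^-1)%g; split=> //.
    by apply: words2M; [exact: letters_B|exact: letters_MV].
  have [wG _] := WGd w wW.
  rewrite -mul//; last 2 first.
  - exact/words2_words4/letters_words2/letters_B.
  - exact/words2_words4/letters_words2/letters_MV.
  rewrite eq mul ?mulgV ?one//.
  exact/words2_words4/letters_words2/letters_MV.
have := ab_id (fun h => x (act v h)) 1%g; rewrite !sigmaE one// => <-.
congr (a _); apply/funext => m; rewrite sigmaE mul1g.
by congr (b _).
Qed.

(** The trace left by sigma t (sigma s x0) g0 <> x0 g0 around the centre w: the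
    images satisfy the condition, a copy of x0 around w does not. *)
Definition condition (w : V) : set XV :=
  [set y | f (g y) (act w g0) = (y : V -> X) (act w g0)]%classic.

Lemma sigma_on_center y w : w \in W -> f (g y) (act w g0) =
  t g0 (fun m : M => s (g0 * val m)%g (fun m' : M =>
    y (act w (g0 * val m * val m')%g))).
Proof.
move=> wW; rewrite sigma_on_in//; last exact/letters_words2/letters_B.
congr (t g0 _); apply/funext => m; rewrite sigma_on_in//.
by apply: words2M; [exact: letters_B|exact: letters_M].
Qed.

Lemma window_words4 h : h \in window -> h \in words4.
Proof.
rewrite in_fset1U => /predU1P[->|].
  exact/words2_words4/letters_words2/letters_B.
case/imfset2P => m mM [m' m'M ->]; apply: words4M; last first.
  exact/letters_words2/(letters_M [` m'M]%fset).
by apply: words2M; [exact: letters_B|exact: (letters_M [` mM]%fset)].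
Qed.

Lemma window_center : g0 \in window. Proof. by rewrite in_fset1U eqxx. Qed.

Lemma window_mem (m m' : M) : (g0 * val m * val m')%g \in window.
Proof.
rewrite in_fset1U; apply/orP; right; apply/imfset2P.
by exists (val m); [exact: valP|exists (val m') => //; exact: valP].
Qed.

Lemma condition_image w x : w \in W -> condition w (f x).
Proof.
move=> wW; have [_ _ WGd _] := packed; rewrite /condition /=.
rewrite !sigma_on_in//; try exact/letters_words2/letters_B.
congr (t g0 _); apply/funext => m; rewrite sigma_on_retract//.
have [_] := WGd w wW; apply; apply/words2_words4/words2M; first exact: letters_B.
exact: letters_M.
Qed.

Lemma condition_local w (y y' : V -> X) : w \in W ->
  (forall h, h \in window -> y (act w h) = y' (act w h)) ->
  condition w y -> condition w y'.
Proof.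
move=> wW yy'; rewrite /condition /= !sigma_on_center// -yy'; last first.
  exact: window_center.
move=> <-; congr (t g0 _); apply/funext => m; congr (s _ _).
by apply/funext => m'; rewrite yy'//; exact: window_mem.
Qed.

Lemma closed_condition w : closed (condition w).
Proof.
pose d (y : XV) : fibre_power bool X :=
  fun e => if e then f (g y) (act w g0) else (y : V -> X) (act w g0).
have [cd _] : is_morphism d.
  apply/fibre_power_morphism => -[]; last exact: is_morphism_proj.
  exact: (is_morphism_comp (is_morphism_proj X (act w g0))
    (is_morphism_comp (sigma_on_morphism t b) (sigma_on_morphism s a))).
move/continuous_closedP: cd => /(_ _ (@variety_separated _ X)).
exact.
Qed.

End OnPacking.

(** The bound q depends on the growths and on the size of the window only, so
    that it is known before the sofic approximation is chosen. *)
Lemma model_contradiction : exists q, forall (V : finType) (act : V -> G -> V)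
    (Gd W : {set V}), packing words4 act Gd W ->
  ((forall x g, sigma (fun=> a) (sigma (fun=> b) x) g = x g) \/
   forall v, v \in Gd -> exists w g, [/\ w \in W, g \in B & v = act w g]) ->
  ~ (q * #|~: Gd| < #|W|)%N.
Proof.
have [r [n [U [xi [chartU coverU]]]]] := variety_charts X.
have irrX : irreducible_union [set: X]%classic.
  rewrite (_ : [set: X]%classic = (\bigcup_i U i)%classic).
    by apply: irreducible_union_bigcup => i; exact: chart_irreducible_union (chartU i).
  by apply/seteqP; split=> // x _; have [i Ux] := coverU x; exists i.
have [C [Z [irrZ closedZ coverZ antiZ]]] := irreducible_components irrX.
have /choice[comp Hcomp] := coverZ.
have C_gt0 : (0 < #|C|)%N by apply/card_gt0P; exists (comp (x0 g0)).
have h_bound c N : (0 < growth Z U xi c N <= N.+1 ^ #|'I_n|)%N.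
  by rewrite (growth_gt0 irrZ xi coverU) growth_le.
have [q Hq] := growth_contradiction R #|` window| C_gt0 h_bound
  (fun c N N' => @growth_mono _ _ _ _ _ _ _ _ c N N').
exists q => V act Gd W packed filler qW.
have [mul _ WGd disj] := packed.
pose Wt : finType := {w | w \in W}.
pose Nb (w : Wt) : {set V} := [set act (val w) (val h) | h : window]%SET.
have NbP (w : Wt) h : h \in window -> act (val w) h \in Nb w.
  by move=> hN; apply/imsetP; exists [` hN]%fset.
pose find (w : Wt) v : option window := [pick h : window | v == act (val w) (val h)].
have findE (w : Wt) h : h \in window ->
    exists2 h' : window, find w (act (val w) h) = Some h' & val h' = h.
  move=> hN; rewrite /find; case: pickP => [h' /eqP eq|none].
    exists h' => //; have [_ ->//] := disj _ _ _ _ (valP w) (valP w)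
      (window_words4 hN) (window_words4 (valP h')) eq.
  by have := none [` hN]%fset; rewrite /= eqxx.
pose p (w : Wt) v : C := comp (x0 (oapp val g0 (find w v))).
have disjNb w w' v : v \in Nb w -> v \in Nb w' -> w = w'.
  move=> /imsetP[h _ ->] /imsetP[h' _ eq]; apply: val_inj.
  by have [] := disj _ _ _ _ (valP w) (valP w')
    (window_words4 (valP h)) (window_words4 (valP h')) eq.
have cardNb w : (#|Nb w| <= #|` window|)%N.
  by rewrite (leq_trans (leq_imset_card _ _))// cardfE.
pose Theta (w : Wt) := condition act W (val w).
have closedTheta w : closed (Theta w) by exact: closed_condition.
have localTheta w (y y' : V -> X) : (forall v, v \in Nb w -> y v = y' v) ->
    Theta w y -> Theta w y'.
  move=> yy'; apply: (condition_local packed (valP w)) => h hN.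
  exact/yy'/NbP.
have proper w (c : V -> C) : (forall v, v \in Nb w -> c v = p w v) ->
    exists y : V -> X, (forall v, Z (c v) (y v)) /\ ~ Theta w y.
  move=> cp; have /choice[z Hz] v : exists z, Z (c v) z.
    by have [] := irrZ (c v).
  pose y v := if find w v is Some h then x0 (val h) else z v.
  have yE h : h \in window -> y (act (val w) h) = x0 h.
    by move=> /(findE w)[h' eq h'E]; rewrite /y eq h'E.
  exists y; split=> [v|].
    rewrite /y; case E: (find w v) => [h|//].
    have vE : v = act (val w) (val h).
      by move: E; rewrite /find; case: pickP => // h' /eqP-> [->].
    rewrite cp; first by rewrite /p E; exact: Hcomp.
    by rewrite vE; apply: NbP; exact: valP.
  rewrite /Theta /condition /= (sigma_on_center packed _ (valP w)).
  rewrite yE; last exact: window_center.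
  move=> eq; apply: bad_g0; rewrite -[RHS]eq sigmaE.
  congr (t g0 _); apply/funext => m; rewrite sigmaE; congr (s _ _).
  by apply/funext => m'; rewrite yE//; exact: window_mem.
have [T [injT [D growthT]]] := growth_inequality irrZ closedZ coverZ antiZ chartU
  coverU disjNb closedTheta localTheta
  (sigma_on_morphism act W t b) (sigma_on_morphism act W s a)
  (sigma_on_retract packed filler)
  (fun w x => condition_image packed filler x (valP w)) proper.
apply: (Hq V Wt Nb p Gd T D disjNb cardNb injT growthT).
by rewrite card_sig; exact: qW.
Qed.


End Model.

(** The equation of the composite at a cell g involves s at g only; so when t
    is constant on g M, with value b, the pair of constant automata given by
    s g and b satisfies the equation everywhere.  Such a g is found in the
    shell around a finite set where t is constant, and beyond this shell both
    automata can be replaced by these constants without affecting the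
    equations.  Without such a g, the finite set B is stable under the
    generators and is the whole of G. *)
Lemma finite_singularity s t (g0 : G) :
  finitely_generated G -> uniformly_bounded_singularity t ->
  (forall x g, sigma s (sigma t x) g = x g) ->
  exists (s' t' : G -> S) (a b : S) (B : {fset G}),
  [/\ forall x g, sigma s' (sigma t' x) g = x g,
      forall g, g \notin B -> s' g = a /\ t' g = b,
      (forall x g, sigma (fun=> a) (sigma (fun=> b) x) g = x g) \/
      forall g, g \in B,
      g0 \in B &
      forall x, sigma t' (sigma s' x) g0 = sigma t (sigma s x) g0].
Proof.
move=> [A genA] ubs st_id.
pose P : {fset G} := (1%g |` (g0 |` (A `|` M)))%fset.
pose L : {fset G} := (P `|` [fset (g^-1)%g | g in P])%fset.
have LP g : g \in P -> g \in L by move=> gP; rewrite in_fsetU gP.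
have LV g : g \in L -> (g^-1)%g \in L.
  rewrite in_fsetU => /orP[gP|/imfsetP[h /= hP ->]]; last by rewrite invgK LP.
  by rewrite in_fsetU; apply/orP; right; exact: in_imfset.
have L1 : 1%g \in L by apply: LP; rewrite !inE eqxx.
have L0 : g0 \in L by apply: LP; rewrite !inE eqxx orbT.
have LA g : g \in A -> g \in L by move=> gA; apply: LP; rewrite !inE gA !orbT.
have LM (m : M) : val m \in L by apply: LP; rewrite !inE (valP m) !orbT.
pose L2 : {fset G} := [fset (g * h)%g | g in L, h in L]%fset.
pose E : {fset G} := [fset (g * h)%g | g in L2, h in L]%fset.
have L2M g h : g \in L -> h \in L -> (g * h)%g \in L2.
  by move=> gL hL; exact: in_imfset2.
have EM g h : g \in L2 -> h \in L -> (g * h)%g \in E.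
  by move=> gL hL; exact: in_imfset2.
have E3 g h l : g \in L -> h \in L -> l \in L -> (g * h * l)%g \in E.
  by move=> gL hL lL; apply: EM => //; exact: L2M.
have LE g : g \in L -> g \in E.
  by move=> gL; have := E3 g 1%g 1%g gL L1 L1; rewrite !mulg1.
have EV : [fset (e^-1)%g | e in E]%fset = E.
  have sub e : e \in E -> (e^-1)%g \in E.
    move=> /imfset2P[/= _ /imfset2P[/= g gL [h hL ->]] [l lL ->]].
    by rewrite !invgM mulgA; apply: E3; exact: LV.
  apply/fsetP => g; apply/imfsetP/idP => [[e /= eE ->]|gE]; first exact: sub.
  by exists (g^-1)%g; rewrite ?invgK//; exact: sub.
have [F /fsubsetP EF constF] := ubs E (LE _ L1) EV.
pose B : {fset G} := [fset (f * l)%g | f in F, l in L]%fset.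
have BM f l : f \in F -> l \in L -> (f * l)%g \in B.
  by move=> fF lL; exact: in_imfset2.
have FB f : f \in F -> f \in B by move=> fF; rewrite -[f]mulg1; exact: BM.
have shell g m : g \in B -> m \in L ->
    (g * m)%g \in [fset (f * e)%g | f in F, e in E]%fset.
  move=> /imfset2P[/= f fF [l lL ->]] mL; rewrite -mulgA.
  by apply: in_imfset2 => //; rewrite -[m]mulg1 mulgA; exact: E3.
have notF g m : g \notin B -> m \in L -> (g * m)%g \notin F.
  by move=> gB mL; apply: contraNN gB => gmF; rewrite -(mulgK m g) BM ?LV.
have [[g [l [gB lL glB]]]|closedB] := pselect (exists g l,
    [/\ g \in B, l \in L & (g * l)%g \notin B]); last first.
  exists s, t, (s 1%g), (s 1%g), B.
  have B1 : 1%g \in B by apply/FB/EF/LE.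
  have BL g l : g \in B -> l \in L -> (g * l)%g \in B.
    by move=> gB lL; apply/negPn/negP => nB; apply: closedB; exists g, l.
  have allB g : g \in B.
    have := genA [pred h | `[< forall g, g \in B ->
      (g * h)%g \in B /\ (g * h^-1)%g \in B >]].
    move=> /(_ _ _ g)/asboolP/(_ 1%g B1)[]; last by rewrite mul1g.
      split=> [|h h' /asboolP Hh /asboolP Hh']; apply/asboolP => x xB.
        by rewrite invg1 mulg1.
      rewrite invgM invgK !mulgA.
      by split; [case: (Hh x xB) => + _ => /Hh'[]|case: (Hh' x xB) => + _ => /Hh[]].
    move=> h hA; apply/asboolP => x xB.
    by split; apply: BL => //; [exact: LA|exact/LV/LA].
  by split=> // [h|]; [rewrite allB|right].
pose g1 := (g * l)%g; pose a := s g1; pose b := t g1.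
have g1FE : g1 \in ([fset (f * e)%g | f in F, e in E] `\` F)%fset.
  by rewrite in_fsetD shell// andbT; apply: contraNN glB; exact: FB.
have tb h : h \in [fset (f * e)%g | f in F, e in E]%fset -> h \notin F -> t h = b.
  by move=> hFE hF; apply: constF => //; rewrite in_fsetD hF.
have g1M (m : M) : t (g1 * val m)%g = b.
  apply: tb; last exact: notF (LM m).
  move: gB => /imfset2P[/= f fF [l' l'L gE]].
  rewrite /g1 gE -!mulgA; apply: in_imfset2 => //=.
  by rewrite mulgA; exact: (E3 _ _ _ l'L lL (LM m)).
clearbody g1.
pose s' h := if h \in B then s h else a.
pose t' h := if h \in B then t h else b.
have t'in h (m : M) : h \in B -> t' (h * val m)%g = t (h * val m)%g.
  move=> hB; rewrite /t'; case: ifPn => // nB; rewrite tb//; first exact: shell (LM m).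
  by apply: contraNN nB; exact: FB.
have t'out h (m : M) : h \notin B -> t' (h * val m)%g = b.
  move=> hB; rewrite /t'; case: ifPn => // mB; apply: tb; last exact: notF (LM m).
  by have := shell _ _ mB L1; rewrite mulg1.
have ab_id x h : sigma (fun=> a) (sigma (fun=> b) x) h = x h.
  have := st_id (fun y => x (h * g1^-1 * y)%g) g1.
  rewrite !sigmaE mulgVK => <-; congr (s g1 _); apply/funext => m.
  rewrite !sigmaE g1M; congr (b _); apply/funext => m'.
  by rewrite !mulgA mulgVK.
exists s', t', a, b, B; split.
- move=> x h; rewrite sigmaE /s'; case: ifPn => hB.
    rewrite -[RHS]st_id sigmaE; congr (s h _); apply/funext => m.
    by rewrite !sigmaE t'in.
  rewrite -[RHS]ab_id sigmaE; congr (a _); apply/funext => m.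
  by rewrite !sigmaE t'out.
- by move=> h hB; rewrite /s' /t' (negPf hB).
- by left.
- exact/FB/EF/LE.
- move=> x; rewrite !sigmaE /t' FB ?EF ?LE//; congr (t g0 _).
  apply/funext => m; rewrite !sigmaE /s' ifT//; apply: BM => //.
  exact/EF/LE.
Qed.

End Automata.

Theorem theoremE (R : realType) (G : groupType) (k : closedFieldType)
    (X : variety k) (M : {fset G}) (s t : G -> var_morphism (fibre_power M X) X) :
  finitely_generated G ->
  sofic R G ->
  uniformly_bounded_singularity s ->
  uniformly_bounded_singularity t ->
  sigma s \o sigma t = id ->
  sigma t \o sigma s = id.
Proof.
move=> fgG soficG _ ubs_t st_id; apply/funext => x; apply/funext => g0 /=.
have {}st_id y g : sigma s (sigma t y) g = y g.
  by have := congr1 (fun h => h y g) st_id.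
have [s' [t' [a [b [B [st'_id out filler g0B tsE]]]]]] :=
  finite_singularity g0 fgG ubs_t st_id.
rewrite -tsE; apply: contrapT => bad.
have [q Hq] := model_contradiction R st'_id (fun g gB => (out g gB).1)
  (fun g gB => (out g gB).2) g0B bad.
have K1 : 1%g \in words4 M B by apply/words2_words4/letters_words2/letters1.
case: filler => [ab_id|allB].
  have [V [act [Gd [W [packed qW]]]]] := sofic_packing q soficG K1.
  by apply: (Hq V act Gd W packed _ qW); left.
(* When G is finite the action of G on itself serves as the packing. *)
pose act (v : B) (g : G) : B := [` allB (val v * g)%g]%fset.
apply: (Hq B act finset.setT [set [` allB 1%g]%fset]%SET).
- split=> [v g h _ _ _|v _|w _|w w' g g'].
  + by apply: val_inj; rewrite /= mulgA.
  + by apply: val_inj; rewrite /= mulg1.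
  + by split=> [|g _]; rewrite inE.
  + rewrite !inE => /eqP-> /eqP-> _ _ /(congr1 val) /=.
    by rewrite !mul1g.
- right=> v _; exists [` allB 1%g]%fset, (val v); split=> //.
  + by rewrite inE.
  + by apply: val_inj; rewrite /= mul1g.
- by rewrite finset.setCT cards0 muln0 cards1.
Qed.
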